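(* Let $\mathcal{X}_1,\mathcal{X}_2\subset\mathbb{R}^d$ be compact convex sets and let $k\in\mathbb{N}^*$. If $c\in\mathcal{C}^{k+1}(\mathcal{X}_1\times\mathcal{X}_2)$, then there exists $C>0$ that only depends on $\Vert c\Vert_{\mathcal{C}^{k+1}}$ such that for all $\boldsymbol{\mu},\boldsymbol{\mu}'\in\mathcal{P}(\mathcal{X}_1)\times\mathcal{P}(\mathcal{X}_2)$, $$\Vert S(\boldsymbol{\mu})-S(\boldsymbol{\mu}')\Vert_{\tilde{\mathcal{C}}^k}\leq C\,\boldsymbol{W_2}(\boldsymbol{\mu},\boldsymbol{\mu}').$$
   Context: $\mathbb{N}^*=\mathbb{N}\setminus\{0\}$. $\mathcal{P}(\mathcal{X}_i)$ is the set of Borel probability measures on $\mathcal{X}_i$. For a compact convex set $K$ of a Euclidean space $\mathbb{R}^m$, $\mathcal{C}^k(K)$ is the space of functions on $K$ that admit a $\mathcal{C}^k$ extension to $\mathbb{R}^m$, with norm $\Vert f\Vert_{\mathcal{C}^k}=\inf_{\tilde f}\sup_{|\alpha|\le k}\Vert\partial^\alpha\tilde f\Vert_\infty$, the infimum being over extensions $\tilde f$ of $f$ to $\mathbb{R}^m$. Quotient space: $\tilde{\mathcal{C}}^k=(\mathcal{C}^k(\mathcal{X}_1)\times\mathcal{C}^k(\mathcal{X}_2))/\sim$, where $(\phi_1,\phi_2)\sim(\psi_1,\psi_2)$ iff there is $\kappa\in\mathbb{R}$ with $\phi_1=\psi_1+\kappa$ and $\phi_2=\psi_2-\kappa$. Its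 norm is $\Vert(\phi_1,\phi_2)\Vert_{\tilde{\mathcal{C}}^k}=\inf_{\kappa\in\mathbb{R}}\Vert\phi_1-\kappa\Vert_{\mathcal{C}^k}+\Vert\phi_2+\kappa\Vert_{\mathcal{C}^k}$. Schrödinger map: for $\boldsymbol{\mu}=(\mu_1,\mu_2)$, $S(\boldsymbol{\mu})\in\tilde{\mathcal{C}}^k$ is the unique (in the quotient space) class of $(\phi_1,\phi_2)$ satisfying, for every $(x_1,x_2)\in\mathcal{X}_1\times\mathcal{X}_2$, $$\phi_1(x_1)=-\log\int_{\mathcal{X}_2}e^{\phi_2(x_2)-c(x_1,x_2)}\,d\mu_2(x_2),\qquad \phi_2(x_2)=-\log\int_{\mathcal{X}_1}e^{\phi_1(x_1)-c(x_1,x_2)}\,d\mu_1(x_1).$$ $W_2(\mu,\nu)=\big(\min_{\gamma\in\Pi(\mu,\nu)}\int\Vert y-x\Vert^2d\gamma(x,y)\big)^{1/2}$, where $\Pi(\mu,\nu)$ is the set of probability measures with marginals $\mu,\nu$, and $\boldsymbol{W_2}(\boldsymbol{\mu},\boldsymbol{\nu})=(W_2(\mu_1,\nu_1)^2+W_2(\mu_2,\nu_2)^2)^{1/2}$. *)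

(* Defs.v *)
From HB Require Import structures.
From mathcomp Require Import all_boot all_order all_algebra.
From mathcomp Require Import ring_quotient.
From mathcomp Require Import all_classical all_reals all_analysis.

Set Implicit Arguments.
Unset Strict Implicit.
Unset Printing Implicit Defensive.

Import Order.TTheory GRing.Theory Num.Theory.
Import numFieldNormedType.Exports.

Local Open Scope classical_set_scope.
Local Open Scope ring_scope.
Local Open Scope quotient_scope.

Section Ck.
Context {R : realType} {m : nat}.
Implicit Types (f g : 'rV[R]_m -> R) (K : set 'rV[R]_m) (k : nat).

Definition pderiv (i : 'I_m) f : 'rV[R]_m -> R :=
  fun x => 'D_(delta_mx 0 i) f x.

Fixpoint Ck k f : Prop :=
  if k is k'.+1 then
    continuous f /\
    forall i, (forall x, derivable f x (delta_mx 0 i)) /\ Ck k' (pderiv i f)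
  else continuous f.

(* The derivative of multi-index alpha, the coordinates being differentiated
   in increasing order; the order is immaterial for functions of class C^k
   with k >= |alpha|. *)
Definition mderiv (alpha : {ffun 'I_m -> nat}) f : 'rV[R]_m -> R :=
  foldl (fun h i => iter (alpha i) (pderiv i) h) f (enum 'I_m).

Definition mindex_le k : set {ffun 'I_m -> nat} :=
  [set alpha | (\sum_i alpha i <= k)%N].

Definition Ck_norm_full k f : \bar R :=
  ereal_sup [set `|mderiv alpha f x|%:E | alpha in mindex_le k & x in setT].

(* A function on K is represented by a function on the whole space, of which
   only the values on K matter. *)
Definition Ck_ext k K f : set ('rV[R]_m -> R) :=
  [set g | Ck k g /\ {in K, g =1 f}].

Definition Ck_on k K : {pred ('rV[R]_m -> R)} :=
  fun f => `[< Ck_ext k K f !=set0 >].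

Definition Ck_norm k K f : \bar R :=
  ereal_inf [set Ck_norm_full k g | g in Ck_ext k K f].

Lemma eq_Ck_norm k K f g : {in K, f =1 g} -> Ck_norm k K f = Ck_norm k K g.
Proof.
move=> fg; rewrite /Ck_norm; congr (ereal_inf (_ @` _)).
by apply/seteqP; split => h [Ch hE]; split => // x xK; rewrite hE// fg.
Qed.

Lemma Ck_cst k (a : R) : Ck k (cst a).
Proof.
elim: k a => [|k IH] a /=; first by exact: cst_continuous.
split; first by exact: cst_continuous.
move=> i; split; first by move=> x; exact: (derivable_cst (W := R)).
suff -> : pderiv i (cst a) = cst 0 by exact: IH.
by apply/funext => x; rewrite /pderiv (derive_cst (W := R)).
Qed.

Lemma CkB k f g : Ck k f -> Ck k g -> Ck k (f - g).
Proof.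
elim: k f g => [|k IH] f g /= => [cf cg x|[cf df] [cg dg]].
  exact: (continuousB (V := R) (cf x) (cg x)).
split; first by move=> x; exact: (continuousB (V := R) (cf x) (cg x)).
move=> i; have [df1 df2] := df i; have [dg1 dg2] := dg i.
split; first by move=> x; exact: derivableB.
suff -> : pderiv i (f - g) = pderiv i f - pderiv i g by exact: IH.
by apply/funext => x; rewrite /pderiv deriveB.
Qed.

Lemma Ck_on_zmod_closed k K : zmod_closed (Ck_on k K).
Proof.
split=> [|f g].
  by apply/asboolP; exists 0; split => //; exact: (Ck_cst k 0).
move=> /asboolP[f' [Cf f'E]] /asboolP[g' [Cg g'E]].
apply/asboolP; exists (f' - g'); split; first exact: CkB.
by move=> x xK; rewrite !fctE f'E// g'E.
Qed.

HB.instance Definition _ k K :=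
  GRing.isZmodClosed.Build ('rV[R]_m -> R) (Ck_on k K) (Ck_on_zmod_closed k K).

Record CkFun k K := MkCkFun {
  ckfun :> 'rV[R]_m -> R ;
  ckfunP : ckfun \in Ck_on k K }.

HB.instance Definition _ k K := [isSub for @ckfun k K].
HB.instance Definition _ k K := [Choice of CkFun k K by <:].
HB.instance Definition _ k K := [SubChoice_isSubZmodule of CkFun k K by <:].

End Ck.

Arguments CkFun {R m} k K.

Section Ctilde.
Context {R : realType} {d : nat} (k : nat) (X1 X2 : set 'rV[R]_d).

Local Notation pairs := (CkFun k X1 * CkFun k X2)%type.

(* The pairs equivalent to (0, 0), for equality of functions on X1 and X2. *)
Definition cst_pairs : {pred pairs} := fun phi =>
  `[< exists kappa : R, {in X1, phi.1 =1 cst kappa} /\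
                        {in X2, phi.2 =1 cst (- kappa)} >].

Lemma cst_pairs_zmod_closed : zmod_closed cst_pairs.
Proof.
split=> [|phi psi].
  by apply/asboolP; exists 0; rewrite oppr0.
move=> /asboolP[a [a1 a2]] /asboolP[b [b1 b2]].
apply/asboolP; exists (a - b); split=> x xX.
  have -> : (phi - psi).1 x = phi.1 x - psi.1 x by [].
  by rewrite a1// b1.
have -> : (phi - psi).2 x = phi.2 x - psi.2 x by [].
by rewrite a2// b2//= opprB opprK addrC.
Qed.

HB.instance Definition _ :=
  GRing.isZmodClosed.Build pairs cst_pairs cst_pairs_zmod_closed.

Definition Ctilde : Type := {ideal_quot cst_pairs}.

HB.instance Definition _ := EqQuotient.on Ctilde.
HB.instance Definition _ := GRing.Zmodule.on Ctilde.

Definition pair_norm (phi1 phi2 : 'rV[R]_d -> R) : \bar R :=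
  ereal_inf [set (Ck_norm k X1 (fun x => phi1 x - kappa)%R +
                  Ck_norm k X2 (fun x => phi2 x + kappa)%R)%E | kappa in setT].

Definition Ctilde_norm (s : Ctilde) : \bar R :=
  pair_norm (repr s).1 (repr s).2.

Lemma Ctilde_norm_pi (phi : pairs) :
  Ctilde_norm (\pi_Ctilde phi) = pair_norm phi.1 phi.2.
Proof.
have : (repr (\pi_Ctilde phi) - phi) \in cst_pairs.
  by rewrite Quotient.idealrBE reprK.
rewrite /Ctilde_norm; move: (repr _) => psi /asboolP[a [a1 a2]].
have e1 : {in X1, forall x, psi.1 x = phi.1 x + a}.
  by move=> x /a1 /= <-; rewrite addrC -[RHS]/(psi.1 x - phi.1 x + phi.1 x) subrK.
have e2 : {in X2, forall x, psi.2 x = phi.2 x - a}.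
  by move=> x /a2 /= <-; rewrite addrC -[RHS]/(psi.2 x - phi.2 x + phi.2 x) subrK.
congr ereal_inf; apply/seteqP; split => _ [t _ <-].
  exists (t - a) => //; congr (_ + _)%E; apply: eq_Ck_norm => x xX.
    by rewrite e1// opprB addrA (addrAC _ a).
  by rewrite e2// addrA addrAC.
exists (t + a) => //; congr (_ + _)%E; apply: eq_Ck_norm => x xX.
  by rewrite e1// opprD addrACA subrr addr0.
by rewrite e2// addrACA addNr addr0.
Qed.

End Ctilde.

Arguments Ctilde {R d} k X1 X2.

Section Schrodinger.
Context {R : realType} {d : nat}.
Implicit Types (X : set 'rV[R]_d) (c : 'rV[R]_(d + d) -> R).

Definition Rd : measurableType _ := g_sigma_algebraType (@open 'rV[R]_d).
Implicit Types mu nu : probability Rd R.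

(* Borel probability measures on a closed set X are identified with the Borel
   probability measures on R^d giving mass 1 to X. *)
Definition prob_on X : set (probability Rd R) := [set mu | mu X = 1%E].

Definition prod_set (X1 X2 : set 'rV[R]_d) : set 'rV[R]_(d + d) :=
  [set row_mx x1 x2 | x1 in X1 & x2 in X2].

Definition schrodinger_system c (X1 X2 : set 'rV[R]_d)
    (mu1 mu2 : probability Rd R) (phi1 phi2 : 'rV[R]_d -> R) :=
  forall x1 x2, X1 x1 -> X2 x2 ->
    phi1 x1 =
      - ln (\int[mu2]_(y in (X2 : set Rd)) expR (phi2 y - c (row_mx x1 y))) /\
    phi2 x2 =
      - ln (\int[mu1]_(y in (X1 : set Rd)) expR (phi1 y - c (row_mx y x2))).

(* S(mu1, mu2), the default value 0 being irrelevant since the class exists and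
   is unique when c is regular and mu1, mu2 are probabilities on X1, X2. *)
Definition schrodinger_map k c (X1 X2 : set 'rV[R]_d)
    (mu1 mu2 : probability Rd R) : Ctilde k X1 X2 :=
  xget 0 [set \pi_(Ctilde k X1 X2) phi |
    phi in [set phi : CkFun k X1 * CkFun k X2 |
      schrodinger_system c X1 X2 mu1 mu2 phi.1 phi.2]].

(* The library norm on 'rV[R]_d is the sup norm, hence this Euclidean one. *)
Definition enorm (x : 'rV[R]_d) : R := Num.sqrt (\sum_i x 0 i ^+ 2).

Definition couplings mu nu : set (probability (Rd * Rd)%type R) :=
  [set gamma | forall A : set Rd, measurable A ->
    pushforward gamma fst A = mu A /\ pushforward gamma snd A = nu A].

Local Open Scope ereal_scope.

Definition W2 mu nu : \bar R :=
  (ereal_inf [set \int[gamma]_z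
      ((enorm ((z.2 : 'rV[R]_d) - (z.1 : 'rV[R]_d)) ^+ 2)%R)%:E |
    gamma in couplings mu nu]) `^ 2^-1.

Definition W2_pair (mu1 mu2 nu1 nu2 : probability Rd R) : \bar R :=
  (W2 mu1 nu1 ^+ 2 + W2 mu2 nu2 ^+ 2) `^ 2^-1.

End Schrodinger.

Arguments Rd R d : clear implicits.

(* Main.v *)
Require Import Defs.
From mathcomp Require Import all_boot all_order all_algebra.
From mathcomp Require Import all_classical all_reals all_analysis.
From mathcomp Require Import ring lra.
From mathcomp Require Import measurable_realfun.

(** Let g be an extension of the cost c to the whole space whose derivatives of
    order at most k+1 are bounded by some M > ||c||; such a g exists as soon as
    the norm of c is finite, which a cutoff guarantees since the sets are
    compact ([Ck_norm_lt_pinfty]).  Replacing c by g, the right-hand sides of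
    the Schrödinger system make sense at every point of R^d and extend the
    potentials there, so that only M matters from now on.

    Each equation of the system says that one potential is the transform
    T phi (x) = - log (integral of exp (phi - g (x, .))) of the other.  The
    argument is that T contracts the oscillation of the difference of two
    functions by the factor 1 - exp (- 4 M) ([stransform_contraction]): the
    probability densities proportional to exp (psi - g (x, .)) for different
    points x are comparable with the constant exp (- 4 M).  This gives
    - the existence of a solution: iterating the composition of both transforms,
      normalised at the origin, yields a fixed point up to an additive constant,
      and Fubini's theorem shows that the constant is zero ([solution_exists]);
    - the stability of the solutions: replacing the measure mu by mu' moves
      T phi by at most a multiple of W_2 (mu, mu'), because
      exp (phi - g (x, .)) is Lipschitz continuous, and the contraction absorbs
      the remaining term.  After normalisation at the origin the potentials of
      both systems therefore differ, uniformly, by at most a constant times the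
      distance of the measures ([solution_stable]).

    Uniform estimates become C^k estimates because T regularises.  The potential
    is - log F, where F (x) is the integral of exp (- g (x, .)) against the
    weighted measure exp (phi) mu.  The derivatives of F fall on the kernel, and
    a derivative of order at most k of the kernel is bounded and Lipschitz
    continuous in the other variable since g has k+1 bounded derivatives
    ([bC_kernel]).  Hence F - F' is bounded in C^k by the uniform distance of the
    weights plus the distance of the measures, and so is log F - log F'
    ([potential_diff]).

    The measures enter only as positive normalised functionals on continuous
    functions ([state]), compared on Lipschitz functions ([dual_close]); the
    transport distance controls this comparison ([dual_close_W2]). *)

Set Implicit Arguments.
Unset Strict Implicit.
Unset Printing Implicit Defensive.

Import Order.TTheory GRing.Theory Num.Theory.
Import numFieldNormedType.Exports.

Local Open Scope classical_set_scope.
Local Open Scope ring_scope.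

(** * Derivatives along lines, Lipschitz functions and Schwarz' theorem *)

Lemma is_derive_along (R : realType) (V : normedModType R) (f : V -> R) x v df :
  is_derive x v f df <-> is_derive (0 : R) (1 : R) (fun h : R => f (h *: v + x)) df.
Proof.
have eqd : (fun h : R => h^-1 *: ((f \o shift x) (h *: v) - f x)) =
    (fun h : R => h^-1 *: (((fun t : R => f (t *: v + x)) \o shift 0) (h *: 1)
      - f (0 *: v + x))).
  by apply/funext => h /=; rewrite addr0 scale0r add0r [_%:A]mulr1.
split => -[d1 d2].
  by apply: DeriveDef; [exact: (derivable1P _ _ _).1 | rewrite -d2 /derive eqd].
by apply: DeriveDef; [exact: (derivable1P _ _ _).2 | rewrite -d2 /derive eqd].
Qed.

Section Lines.
Context {R : realType} {V : normedModType R}.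
Implicit Types (f g : V -> R) (x v : V).

Lemma is_derive_comp1 (p : R -> R) f x v a :
  derivable f x v -> is_derive (f x) 1 p a ->
  is_derive x v (p \o f) (a * 'D_v f x).
Proof.
move=> /derivableP/is_derive_along df dp; apply: (is_derive_along _ _ _ _).2.
apply: (is_derive1_comp (f := p) (g := fun h : R => f (h *: v + x)) (x := 0)) => //.
by rewrite scale0r add0r.
Qed.

Lemma derivable_shift f a x v : derivable f (a + x) v ->
  is_derive x v (fun z => f (a + z)) ('D_v f (a + x)).
Proof.
move=> /derivableP/is_derive_along df; apply: (is_derive_along _ _ _ _).2.
have -> : (fun h : R => f (a + (h *: v + x))) = (fun h : R => f (h *: v + (a + x))) => //.
by apply/funext => h; rewrite addrCA.
Qed.

Lemma is_derive_line f x v (t : R) : derivable f (t *: v + x) v ->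
  is_derive t 1 (fun s : R => f (s *: v + x)) ('D_v f (t *: v + x)).
Proof.
move=> /derivableP/is_derive_along df; apply: (is_derive_along _ _ _ _).2.
have -> : (fun h : R => f ((h *: 1 + t) *: v + x)) =
          (fun h : R => f (h *: v + (t *: v + x))) => //.
by apply/funext => h; rewrite scalerDl addrA [_%:A]mulr1.
Qed.

Lemma MVT_line f x v (h : R) : (forall t : R, derivable f (t *: v + x) v) ->
  exists2 s : R, `|s| <= `|h| & f (h *: v + x) - f x = h * 'D_v f (s *: v + x).
Proof.
move=> df; set g := fun s : R => f (s *: v + x).
have dg (s : R) : is_derive s 1 g ('D_v f (s *: v + x)) by exact: is_derive_line.
have cg (A : set R) : {within A, continuous g}.
  apply: continuous_subspaceT => s.
  exact/differentiable_continuous/derivable1_diffP/ex_derive.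
have g0 : f x = g 0 by rewrite /g scale0r add0r.
rewrite -/(g h) g0; have [h0|/ltW h0] := leP 0 h.
  have [s] := MVT_segment h0 (fun s _ => dg s) (cg _).
  rewrite in_itv/= subr0 => /andP[s0 sh] ->; exists s; last by rewrite mulrC.
  by rewrite !ger0_norm.
have [s] := MVT_segment h0 (fun s _ => dg s) (cg _).
rewrite in_itv/= sub0r => /andP[hs s0] gE; exists s; first by rewrite !ler0_norm// lerN2.
by rewrite -[LHS]opprB gE mulrN opprK mulrC.
Qed.

(** The criterion used for parameter integrals and for functions defined by cases:
    unlike a limit, a quadratic remainder passes through a functional. *)
Lemma is_derive_quad f x v d (K : R) :
  (forall h : R, `|h| <= 1 -> `|f (h *: v + x) - f x - h * d| <= K * h ^+ 2) ->
  is_derive x v f d.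
Proof.
move=> fq.
have K0 : 0 <= K.
  by have := fq 1; rewrite normr1 lexx expr1n mulr1 => /(_ isT); exact: le_trans.
suff H : h^-1 *: ((f \o shift x) (h *: v) - f x) @[h --> 0^'] --> d.
  by apply: DeriveDef; [apply/cvg_ex; exists d | exact: cvg_lim H].
apply/cvgrPdist_le => e e0; near=> h.
have h0 : h != 0 by near: h; exact: nbhs_dnbhs_neq.
have h1 : `|h| <= 1 by near: h; apply: dnbhs0_le.
have hK : `|h| <= e / (K + 1).
  by near: h; apply: dnbhs0_le; rewrite divr_gt0// ltr_wpDl.
rewrite /= -(@ler_pM2l _ `|h|) ?normr_gt0// -normrM mulrBr /GRing.scale/= mulVKf//.
rewrite distrC; apply: le_trans (fq _ h1) _.
rewrite -real_normK ?num_real// expr2 mulrA [leRHS]mulrC ler_wpM2r//.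
have : (K + 1) * `|h| <= e by rewrite mulrC -ler_pdivlMr// ltr_wpDl.
by apply: le_trans; rewrite ler_wpM2r// lerDl.
Unshelve. all: by end_near. Qed.

End Lines.

Section LipschitzFunctions.
Context {R : realType} {V W : normedModType R}.

Definition lip (L : R) (f : V -> W) := forall x y, `|f x - f y| <= L * `|x - y|.

Lemma lip_continuous L f : lip L f -> continuous f.
Proof.
move=> fL x; apply/cvgrPdist_le => e e0; near=> y.
apply: le_trans (fL _ _) _.
have L1 : 0 < `|L| + 1 by rewrite ltr_wpDl.
apply: (@le_trans _ _ ((`|L| + 1) * `|x - y|)).
  by rewrite ler_wpM2r// (le_trans (ler_norm L))// lerDl.
rewrite mulrC -ler_pdivlMr//; near: y.
by apply: cvgr_dist_le; [exact: cvg_id | rewrite divr_gt0].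
Unshelve. all: by end_near. Qed.

Lemma lip_le L L' f : L <= L' -> lip L f -> lip L' f.
Proof. by move=> LL fL x y; rewrite (le_trans (fL _ _))// ler_wpM2r. Qed.

End LipschitzFunctions.

Section Partial.
Context {R : realType} {m : nat}.
Implicit Types (f g : 'rV[R]_m -> R) (x v : 'rV[R]_m) (i j : 'I_m).
Local Notation e i := (delta_mx 0 i : 'rV[R]_m).

(** Two points are joined by changing one coordinate at a time. *)
Lemma lip_of_pderiv (B : R) f :
  (forall i x, derivable f x (e i)) -> (forall i x, `|pderiv i f x| <= B) ->
  lip (m%:R * B) f.
Proof.
move=> df fB x y.
pose z (j : nat) : 'rV[R]_m := \row_i (if (i < j)%N then x 0 i else y 0 i).
have z0 : z 0%N = y by apply/rowP => i; rewrite mxE.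
have zm : z m = x by apply/rowP => i; rewrite mxE ltn_ord.
rewrite -z0 -zm -(telescope_sumr (fun k : nat => f (z k))) //.
rewrite zm z0 big_mkord.
have -> : m%:R * B * `|x - y| = \sum_(i < m) B * `|x - y|.
  by rewrite sumr_const card_ord -mulrnAl mulr_natl.
apply: le_trans (ler_norm_sum _ _ _) _; apply: ler_sum => i _.
have -> : z i.+1 = (x 0 i - y 0 i) *: e i + z i.
  apply/rowP => j; rewrite !mxE ltnS leq_eqVlt eqxx/=.
  have [->|ji] := eqVneq j i; first by rewrite eqxx ltnn mulr1 subrK.
  by rewrite -val_eqE/= in ji; rewrite (negbTE ji) mulr0 add0r.
have [|s _ ->] := @MVT_line _ _ f (z i) (e i) (x 0 i - y 0 i); first by [].
rewrite normrM mulrC ler_pM// ?fB//.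
have -> : x 0 i - y 0 i = (x - y) 0 i by rewrite !mxE.
rewrite {2}/Num.norm/= mx_normrE.
exact: (le_bigmax _ (fun ij : 'I_1 * 'I_m => `|(x - y) ij.1 ij.2|) (0, i)).
Qed.

Let mixed_difference i j f x (h : R) :
  (forall x, derivable f x (e i)) -> (forall x, derivable (pderiv i f) x (e j)) ->
  exists s t : R, [/\ `|s| <= `|h|, `|t| <= `|h| &
    f (h *: e j + (h *: e i + x)) - f (h *: e i + x) - (f (h *: e j + x) - f x) =
    h * (h * pderiv j (pderiv i f) (t *: e j + (s *: e i + x)))].
Proof.
move=> dfi dfij.
have dg z : is_derive z (e i) (fun z => f (h *: e j + z) - f z)
    (pderiv i f (h *: e j + z) - pderiv i f z).
  apply: (@is_deriveB _ _ _ (fun z => f (h *: e j + z)) f).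
    exact: derivable_shift.
  exact: derivableP.
have [|s sh ->] := @MVT_line _ _ (fun z => f (h *: e j + z) - f z) x (e i) h.
  by move=> t; exact: ex_derive.
have [|t th E] := @MVT_line _ _ (pderiv i f) (s *: e i + x) (e j) h.
  by move=> t; exact: dfij.
exists s, t; split => //; congr (h * _).
by rewrite -E; exact: derive_val.
Qed.

(** Schwarz' theorem: by the mean value theorem, used twice, both mixed
    derivatives at points near [x] equal the same second difference quotient. *)
Lemma pderivC i j f : Ck 2 f -> pderiv i (pderiv j f) = pderiv j (pderiv i f).
Proof.
move=> [_ df]; apply/funext => x.
have [dfi [_ dfi']] := df i; have [dfj [_ dfj']] := df j.
have [dfij cij] := dfi' j; have [dfji cji] := dfj' i.
apply/eqP; rewrite -subr_eq0 -normr_eq0 eq_le normr_ge0 andbT.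
apply/ler_addgt0Pl => e e0; rewrite addr0.
have e2 : 0 < e / 2 by rewrite divr_gt0.
have /cvgrPdist_lt/(_ _ e2) /nbhs_ballP[r1 /= r10 H1] := cij x.
have /cvgrPdist_lt/(_ _ e2) /nbhs_ballP[r2 /= r20 H2] := cji x.
pose h := Num.min r1 r2 / 3.
have m0 : 0 < Num.min r1 r2 by rewrite lt_min r10.
have h0 : 0 < h by rewrite divr_gt0.
have near_x i' j' s t : `|s| <= `|h| -> `|t| <= `|h| ->
    `|x - (t *: delta_mx 0 j' + (s *: delta_mx 0 i' + x))| < Num.min r1 r2.
  move=> sh th; rewrite addrA opprD addrCA subrr addr0 normrN.
  apply: le_lt_trans (ler_normD _ _) _.
  have nd k : `|delta_mx 0 k : 'rV[R]_m| <= 1.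
    rewrite /Num.norm/= mx_normrE; apply/bigmax_leP; split => // -[a b] _ /=.
    by rewrite mxE; case: (_ && _); rewrite ?normr1 ?normr0.
  have hE : `|h| = Num.min r1 r2 / 3 by rewrite gtr0_norm.
  have A1 : `|t *: delta_mx 0 j' : 'rV[R]_m| <= Num.min r1 r2 / 3.
    by rewrite normrZ -hE -[leRHS]mulr1 ler_pM.
  have A2 : `|s *: delta_mx 0 i' : 'rV[R]_m| <= Num.min r1 r2 / 3.
    by rewrite normrZ -hE -[leRHS]mulr1 ler_pM.
  by apply: le_lt_trans (lerD A1 A2) _; move: m0; lra.
have [s [t [sh th E1]]] := mixed_difference x h dfi dfij.
have [s' [t' [sh' th' E2]]] := mixed_difference x h dfj dfji.
have E : pderiv j (pderiv i f) (t *: delta_mx 0 j + (s *: delta_mx 0 i + x)) =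
         pderiv i (pderiv j f) (t' *: delta_mx 0 i + (s' *: delta_mx 0 j + x)).
  apply: (@mulfI _ h); first by rewrite gt_eqF.
  apply: (@mulfI _ h); first by rewrite gt_eqF.
  have swap4 (a b c d : R) : a - b - (c - d) = a - c - (b - d) by ring.
  apply: etrans (esym E1) (etrans _ E2).
  by rewrite (addrCA (h *: delta_mx 0 i)); exact: swap4.
have B1 : `|pderiv j (pderiv i f) x - pderiv j (pderiv i f)
     (t *: delta_mx 0 j + (s *: delta_mx 0 i + x))| < e / 2.
  apply: H1; rewrite -ball_normE/=; apply: lt_le_trans (near_x i j s t sh th) _.
  by rewrite ge_min lexx.
have B2 : `|pderiv i (pderiv j f) x - pderiv i (pderiv j f)
     (t' *: delta_mx 0 i + (s' *: delta_mx 0 j + x))| < e / 2.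
  apply: H2; rewrite -ball_normE/=; apply: lt_le_trans (near_x j i s' t' sh' th') _.
  by rewrite ge_min lexx orbT.
rewrite -E in B2; rewrite distrC in B1.
rewrite [e]splitr; apply: le_trans (lerD (ltW B2) (ltW B1)).
exact: ler_distD.
Qed.

End Partial.

(** * Functions with bounded partial derivatives *)

Section BoundedCk.
Context {R : realType} {m : nat}.
Implicit Types (f g : 'rV[R]_m -> R) (x : 'rV[R]_m) (i : 'I_m) (k : nat).
Local Notation e i := (delta_mx 0 i : 'rV[R]_m).

(** The derivatives are taken in every order of the coordinates, unlike in
    [Ck_norm_full]; this makes the class stable under exchange of variables. *)
Fixpoint bC k (B : R) f : Prop :=
  [/\ continuous f, forall x, `|f x| <= B &
    if k is k'.+1 then
      forall i, (forall x, derivable f x (e i)) /\ bC k' B (pderiv i f)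
    else True].

Lemma bC_continuous k B f : bC k B f -> continuous f.
Proof. by case: k => [|k] []. Qed.

Lemma bC_bound k B f x : bC k B f -> `|f x| <= B.
Proof. by case: k => [|k] [] _ /(_ x). Qed.

Lemma bC_ge0 k B f : bC k B f -> 0 <= B.
Proof. by move=> /(@bC_bound _ _ _ 0); exact: le_trans. Qed.

Lemma bC_Ck k B f : bC k B f -> Ck k f.
Proof.
elim: k f => [f []//|k IH f [cf _ df]]; split => // i.
by have [d1 d2] := df i; split => //; exact: IH.
Qed.

Lemma bC_le k B B' f : B <= B' -> bC k B f -> bC k B' f.
Proof.
move=> BB; elim: k f => [f [cf fB _]|k IH f [cf fB df]]; split => //.
- by move=> x; exact: le_trans (fB x) BB.
- by move=> x; exact: le_trans (fB x) BB.
- by move=> i; have [d1 d2] := df i; split => //; exact: IH.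
Qed.

Lemma bCS k B f : bC k.+1 B f -> bC k B f.
Proof.
elim: k f => [f [cf fB df]//|k IH f [cf fB df]]; split => //.
by move=> i; have [d1 d2] := df i; split => //; exact: IH.
Qed.

Lemma bC_sub j k B f : (j <= k)%N -> bC k B f -> bC j B f.
Proof.
by move=> /subnK <-; elim: (k - j)%N => // n IH; rewrite addSn => /bCS.
Qed.

Lemma bC_pderiv k B f i : bC k.+1 B f ->
  (forall x, derivable f x (e i)) /\ bC k B (pderiv i f).
Proof. by move=> [_ _]. Qed.

Lemma bC_lip k B f : bC k.+1 B f -> lip (m%:R * B) f.
Proof.
move=> [_ _ df]; apply: lip_of_pderiv => i x; have [d1 d2] := df i => //.
exact: bC_bound d2.
Qed.

Lemma bCD k A B f g : bC k A f -> bC k B g -> bC k (A + B) (f + g).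
Proof.
elim: k f g => [f g [cf fA _] [cg gB _]|k IH f g [cf fA df] [cg gB dg]].
  split => // x; first exact: (continuousD (cf x) (cg x)).
  by apply: le_trans (ler_normD _ _) _; exact: lerD.
split=> [x|x|i]; first exact: (continuousD (cf x) (cg x)).
  by apply: le_trans (ler_normD _ _) _; exact: lerD.
have [df1 df2] := df i; have [dg1 dg2] := dg i.
split; first by move=> x; exact: derivableD.
suff -> : pderiv i (f + g) = pderiv i f + pderiv i g by exact: IH.
by apply/funext => x; rewrite /pderiv deriveD.
Qed.

Lemma bC_cst k a : bC k `|a| (cst a).
Proof.
elim: k a => [|k IH] a; split=> //; try by move=> x; exact: cst_continuous.
move=> i; split; first by move=> x; exact: (derivable_cst (W := R)).
suff -> : pderiv i (cst a) = cst 0.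
  by apply: bC_le (IH 0); rewrite normr0.
by apply/funext => x; rewrite /pderiv (derive_cst (W := R)).
Qed.

Lemma bCN k B f : bC k B f -> bC k B (- f).
Proof.
elim: k f => [f [cf fB _]|k IH f [cf fB df]].
  by split => // x; [exact: (continuousN (cf x)) | rewrite normrN].
split=> [x|x|i]; [exact: (continuousN (cf x)) | by rewrite normrN |].
have [df1 df2] := df i; split; first by move=> x; exact: derivableN.
suff -> : pderiv i (- f) = - pderiv i f by exact: IH.
by apply/funext => x; rewrite /pderiv deriveN.
Qed.

(** The factor [2 ^ k] counts the terms of the Leibniz formula. *)
Lemma bCM k A B f g : bC k A f -> bC k B g -> bC k (2 ^+ k * (A * B)) (f * g).
Proof.
elim: k A B f g => [A B f g [cf fA _] [cg gB _]|k IH A B f g Hf Hg].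
  split=> // x; first exact: (continuousM (cf x) (cg x)).
  by rewrite expr0 mul1r normrM ler_pM.
have [A0 B0] := (bC_ge0 Hf, bC_ge0 Hg).
have [Hf' Hg'] := (bCS Hf, bCS Hg).
case: Hf Hg => [cf fA df] [cg gB dg].
split=> [x|x|i]; first exact: (continuousM (cf x) (cg x)).
  rewrite normrM; apply: (@le_trans _ _ (A * B)); first by rewrite ler_pM.
  by rewrite ler_peMl ?mulr_ge0// exprn_ege1// ler1n.
have [df1 df2] := df i; have [dg1 dg2] := dg i.
split; first by move=> x; exact: derivableM.
have -> : pderiv i (f * g) = f * pderiv i g + g * pderiv i f.
  by apply/funext => x; rewrite /pderiv deriveM.
rewrite exprS -mulrA mulr_natl mulr2n.
by apply: bCD; [exact: IH | rewrite (mulrC A);  exact: IH].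
Qed.

(** Here and below the bound is chosen before the function: in the end it must
    depend on nothing but the norm of the cost. *)
Lemma bC_expR k B : exists2 B', 0 <= B' &
  forall f, bC k B f -> bC k B' (expR \o f).
Proof.
elim: k => [|k [B' B'0 IH]].
  exists (expR B); first exact: expR_ge0.
  move=> f [cf fB _]; split=> // x.
    by apply: continuous_comp; [exact: cf | exact: continuous_expR].
  by rewrite ger0_norm ?expR_ge0//= ler_expR (le_trans (ler_norm _)).
exists (Num.max (expR B) (2 ^+ k * (B' * B))).
  by rewrite le_max expR_ge0.
move=> f Hf; have Hf' := bCS Hf; case: Hf => cf fB df.
split=> [x|x|i].
- by apply: continuous_comp; [exact: cf | exact: continuous_expR].
- by rewrite le_max ger0_norm ?expR_ge0//= ler_expR (le_trans (ler_norm _)).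
have [df1 df2] := df i.
have dE x : is_derive x (e i) (expR \o f) (expR (f x) * 'D_(e i) f x).
  by apply: is_derive_comp1 => //; exact: is_derive_expR.
split; first by move=> x; exact: ex_derive.
have -> : pderiv i (expR \o f) = (expR \o f) * pderiv i f.
  by apply/funext => x; exact: derive_val.
by apply: bC_le (bCM (IH _ Hf') df2); rewrite le_max lexx orbT.
Qed.

Lemma bC_inv k (B d : R) : 0 < d -> exists2 B', 0 <= B' &
  forall f, (forall x, d <= f x) -> bC k B f -> bC k B' (fun x => (f x)^-1).
Proof.
move=> d0; have bd f : (forall x, d <= f x) -> forall x, `|(f x)^-1| <= d^-1.
  move=> fd x; have fx0 := lt_le_trans d0 (fd x).
  by rewrite gtr0_norm ?invr_gt0// lef_pV2.
elim: k => [|k [B' B'0 IH]].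
  exists d^-1; first by rewrite invr_ge0 ltW.
  move=> f fd [cf fB _]; split=> //; last exact: bd.
  move=> x; apply: continuousV (cf x).
  by rewrite gt_eqF// (lt_le_trans d0 (fd x)).
exists (Num.max d^-1 (2 ^+ k * (2 ^+ k * (B' * B') * B))).
  by rewrite le_max invr_ge0 ltW.
move=> f fd Hf; have Hf' := bCS Hf; case: Hf => cf fB df.
have f0 x : f x != 0 by rewrite gt_eqF// (lt_le_trans d0 (fd x)).
split=> [||i]; first by move=> x; exact: continuousV (f0 x) (cf x).
  by move=> x; rewrite le_max bd.
have [df1 df2] := df i; split; first by move=> x; exact: derivableV.
have -> : pderiv i (fun x => (f x)^-1) =
    - ((fun x => (f x)^-1) * (fun x => (f x)^-1) * pderiv i f).
  apply/funext => x; rewrite /pderiv deriveV// /GRing.scale/= mulNr.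
  by congr (- (_ * _)); rewrite expr2 invfM.
apply/bCN/bC_le/(bCM (bCM (IH _ fd Hf') (IH _ fd Hf')) df2).
by rewrite le_max lexx orbT.
Qed.

Lemma ln_diff_le (a b d : R) : 0 < d -> d <= a -> d <= b ->
  `|ln a - ln b| <= d^-1 * `|a - b|.
Proof.
move=> d0; wlog ab : a b / b <= a => [H da db|da db].
  have [ba|/ltW ab] := leP b a; first exact: H.
  by rewrite distrC (distrC a) H.
have a0 := lt_le_trans d0 da; have b0 := lt_le_trans d0 db.
rewrite !ger0_norm ?subr_ge0 ?ler_ln// -ln_div ?posrE//.
have -> : a / b = 1 + (a - b) / b by field; rewrite gt_eqF.
apply: le_trans (le_ln1Dx _) _.
  by rewrite (lt_le_trans (ltrN10 _))// divr_ge0 ?subr_ge0// ltW.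
by rewrite mulrC ler_wpM2r ?subr_ge0// lef_pV2.
Qed.

(** Linear dependence on the bound [w] of the difference, which is where the
    distance of the measures will appear. *)
Lemma bC_ln_diff k (B d : R) : 0 < d -> exists2 C, 0 <= C &
  forall f g w, (forall x, d <= f x) -> (forall x, d <= g x) ->
    bC k B f -> bC k B g -> bC k w (f - g) ->
    bC k (C * w) (fun x => ln (f x) - ln (g x)).
Proof.
move=> d0.
have cln f : continuous f -> (forall x, d <= f x) -> continuous (@ln R \o f).
  move=> cf fd x; apply: continuous_comp; first exact: cf.
  by apply: continuous_ln; exact: lt_le_trans d0 (fd x).
have c0 f g : continuous f -> continuous g -> (forall x, d <= f x) ->
    (forall x, d <= g x) -> continuous (fun x => ln (f x) - ln (g x)).
  move=> cf cg fd gd x; apply: (@continuousB _ _ _ (@ln R \o f) (@ln R \o g)).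
    exact: cln.
  exact: cln.
have b0 f g w : (forall x, d <= f x) -> (forall x, d <= g x) ->
    (forall x, `|(f - g) x| <= w) ->
    forall x, `|ln (f x) - ln (g x)| <= d^-1 * w.
  move=> fd gd fgw x; apply: le_trans (ln_diff_le d0 (fd x) (gd x)) _.
  by rewrite ler_wpM2l// ?invr_ge0 ?(ltW d0)//; exact: fgw.
case: k => [|k].
  exists d^-1; first by rewrite invr_ge0 ltW.
  move=> f g w fd gd [cf _ _] [cg _ _] [_ fgw _]; split => //; first exact: c0.
  exact: b0.
have [V V0 HV] := bC_inv k B d0.
pose C1 := 2 ^+ k * V + 2 ^+ k * (2 ^+ k * B * (2 ^+ k * (V * V))).
exists (Num.max d^-1 C1); first by rewrite le_max invr_ge0 ltW.
move=> f g w fd gd Hf Hg Hfg.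
have w0 := bC_ge0 Hfg.
have [[Hf' Hg'] Hfg'] := (bCS Hf, bCS Hg, bCS Hfg).
case: Hf Hg Hfg => [cf fB df] [cg gB dg] [_ fgw dfg].
split; first exact: c0.
  move=> x; apply: le_trans (b0 _ _ _ fd gd fgw x) _.
  by rewrite ler_wpM2r// le_max lexx.
move=> i; have [df1 df2] := df i; have [dg1 dg2] := dg i; have [dfg1 dfg2] := dfg i.
have dln h : (forall x, d <= h x) -> (forall x, derivable h x (e i)) ->
    forall x, is_derive x (e i) (@ln R \o h) ((h x)^-1 * 'D_(e i) h x).
  move=> hd dh x; apply: is_derive_comp1 => //; apply: is_derive1_ln.
  exact: lt_le_trans d0 (hd x).
have dd x : is_derive x (e i) (fun x => ln (f x) - ln (g x))
    ((f x)^-1 * 'D_(e i) f x - (g x)^-1 * 'D_(e i) g x).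
  exact: (is_deriveB (dln f fd df1 x) (dln g gd dg1 x)).
split; first by move=> x; exact: ex_derive.
have f0 x : f x != 0 by rewrite gt_eqF// (lt_le_trans d0 (fd x)).
have g0 x : g x != 0 by rewrite gt_eqF// (lt_le_trans d0 (gd x)).
(* The difference of the quotients f'/f - g'/g, written linearly in f - g. *)
have -> : pderiv i (fun x => ln (f x) - ln (g x)) =
    (fun x => (f x)^-1) * pderiv i (f - g) +
    - ((f - g) * pderiv i g * ((fun x => (f x)^-1) * (fun x => (g x)^-1))).
  apply/funext => x; rewrite /pderiv derive_val.
  rewrite -[RHS]/((f x)^-1 * 'D_(e i) (f - g) x +
    - ((f x - g x) * 'D_(e i) g x * ((f x)^-1 * (g x)^-1))).
  rewrite deriveB//; move: ('D_(e i) f x) ('D_(e i) g x) (f0 x) (g0 x).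
  by move: (f x) (g x) => a b a' b' a0 b0'; field; rewrite a0 b0'.
have [IVf IVg] := (HV _ fd Hf', HV _ gd Hg').
apply: bC_le (bCD (bCM IVf dfg2) (bCN (bCM (bCM Hfg' dg2) (bCM IVf IVg)))).
apply: (@le_trans _ _ (C1 * w)); last by rewrite ler_wpM2r// le_max lexx orbT.
by rewrite le_eqVlt; apply/orP; left; apply/eqP; rewrite /C1; ring.
Qed.

End BoundedCk.

(** * Multi-indices, reparametrisation and integration with respect to a parameter *)

Section Words.
Context {R : realType} {m : nat}.
Implicit Types (f g : 'rV[R]_m -> R) (x : 'rV[R]_m) (i j : 'I_m) (k : nat)
  (s t : seq 'I_m).

Definition pderivs s f := foldl (fun h i => pderiv i h) f s.

Lemma Ck_sub n k f : (n <= k)%N -> Ck k f -> Ck n f.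
Proof.
elim: n k f => [|n IH] [|k] f //=; first by move=> _ [].
move=> jk [cf df]; split => // i.
by have [d1 d2] := df i; split => //; exact: IH d2.
Qed.

Lemma pderiv_pderivs s i f : Ck (size s).+1 f ->
  pderiv i (pderivs s f) = pderivs s (pderiv i f).
Proof.
elim: s f => //= j s IH f Cf.
rewrite IH; last by case: Cf => _ /(_ j)[].
by rewrite pderivC//; apply: (@Ck_sub _ (size s).+2).
Qed.

(** The first letter of [s] is moved to the front of [t] by Schwarz' theorem. *)
Lemma pderivs_perm s t f : perm_eq s t -> Ck (size s) f ->
  pderivs s f = pderivs t f.
Proof.
elim: s t f => [|i s IH] t f; first by rewrite perm_sym => /perm_nilP ->.
move=> st; have ti : i \in t by rewrite -(perm_mem st) mem_head.
case/path.splitPr: ti st => t1 t2 st.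
have st12 : perm_eq s (t1 ++ t2).
  by rewrite -(perm_cons i) (perm_trans st)// -(cat1s i t2) perm_catCA perm_refl.
move=> Cf; have Cdf : Ck (size s) (pderiv i f) by case: Cf => _ /(_ i)[].
rewrite /= (IH _ _ st12 Cdf) /pderivs !foldl_cat /=.
congr foldl; rewrite -/(pderivs t1 f) pderiv_pderivs//.
apply: (Ck_sub _ Cf); rewrite /= ltnS (perm_size st12) size_cat; exact: leq_addr.
Qed.

(** The coordinates in increasing order, [i] being repeated [alpha i] times: the
    order in which [mderiv] differentiates. *)
Definition mindex_word (alpha : {ffun 'I_m -> nat}) : seq 'I_m :=
  flatten [seq nseq (alpha i) i | i <- enum 'I_m].

Lemma mderiv_word alpha f : mderiv alpha f = pderivs (mindex_word alpha) f.
Proof.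
rewrite /mderiv /mindex_word; elim: (enum 'I_m) f => //= i l IH f.
rewrite IH {2}/pderivs foldl_cat; congr (pderivs _ _).
elim: (alpha i) f => //= n IHn f.
by rewrite -IHn -iterSr.
Qed.

Lemma size_mindex_word alpha : size (mindex_word alpha) = (\sum_i alpha i)%N.
Proof.
rewrite /mindex_word size_flatten /shape -map_comp sumnE big_map big_enum.
by apply: eq_bigr => i _; rewrite /= size_nseq.
Qed.

Lemma perm_mindex_word s :
  perm_eq s (mindex_word [ffun i => count_mem i s]).
Proof.
apply/allP => i _ /=; apply/eqP.
rewrite count_flatten -map_comp sumnE big_map big_enum /= (bigD1 i)//=.
rewrite big1 => [|j ji].
  by rewrite addn0 count_nseq ffunE /= eqxx mul1n.
by rewrite count_nseq /= (negbTE ji).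
Qed.

Lemma bC_words k B f : Ck k f ->
  (forall s, (size s <= k)%N -> forall x, `|pderivs s f x| <= B) -> bC k B f.
Proof.
elim: k f => [|k IH] f Cf sB.
  by split => // x; exact: (sB [::]).
case: Cf => cf df; split => [//|x|i]; first exact: (sB [::]).
have [d1 d2] := df i; split => //; apply: IH => // s sk; exact: (sB (i :: s)).
Qed.

Lemma bC_pderivs k B f s : bC k B f -> (size s <= k)%N ->
  forall x, `|pderivs s f x| <= B.
Proof.
elim: s k f => [|i s IH] k f; first by move=> fB _ x; exact: bC_bound fB.
by case: k => // k [_ _ /(_ i)[_ d2]] sk; exact: IH d2 _.
Qed.

(** The norm only tests derivatives taken in increasing order of the
    coordinates; Schwarz' theorem extends the bound to all orders. *)
Lemma bC_of_norm k B f : Ck k f -> (Ck_norm_full k f <= B%:E)%E -> bC k B f.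
Proof.
move=> Cf fB; apply: bC_words => // s sk x.
rewrite -lee_fin; apply: le_trans fB; apply: ereal_sup_ubound.
exists [ffun i => count_mem i s].
  by rewrite /mindex_le/= -size_mindex_word -(perm_size (perm_mindex_word s)).
exists x => //; rewrite mderiv_word (pderivs_perm (perm_mindex_word s))//.
exact: (Ck_sub _ Cf).
Qed.

Lemma norm_of_bC k B f : bC k B f -> (Ck_norm_full k f <= B%:E)%E.
Proof.
move=> fB; apply: ge_ereal_sup => _ [alpha ak [x _ <-]].
by rewrite lee_fin mderiv_word (bC_pderivs fB)// size_mindex_word.
Qed.

End Words.

Section RowNorm.
Context {R : realType}.

Lemma coord_le_norm m (z : 'rV[R]_m) i : `|z 0 i| <= `|z|.
Proof.
rewrite {2}/Num.norm/= mx_normrE.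
exact: (le_bigmax _ (fun ij : 'I_1 * 'I_m => `|z ij.1 ij.2|) (0, i)).
Qed.

Lemma rV_norm_le m (z : 'rV[R]_m) (c : R) : 0 <= c ->
  (forall i, `|z 0 i| <= c) -> `|z| <= c.
Proof.
move=> c0 zc; rewrite /Num.norm/= mx_normrE; apply/bigmax_leP.
by split => // -[a b] _ /=; rewrite (ord1 a).
Qed.

Lemma rV_norm_row_mx m n (a : 'rV[R]_m) (b : 'rV[R]_n) (c : R) :
  `|a| <= c -> `|b| <= c -> `|row_mx a b| <= c.
Proof.
move=> ac bc; apply: rV_norm_le; first exact: le_trans ac.
move=> i; rewrite mxE; case: (fintype.split i) => j.
  exact: le_trans (coord_le_norm _ _) ac.
exact: le_trans (coord_le_norm _ _) bc.
Qed.

Lemma delta_row_l m n (i : 'I_m) :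
  delta_mx 0 (lshift n i) = row_mx (delta_mx 0 i) 0 :> 'rV[R]_(m + n).
Proof.
apply/rowP => j; rewrite !mxE; case: split_ordP => l ->; rewrite !mxE.
  by rewrite (inj_eq (@lshift_inj _ _)).
by rewrite eq_rlshift.
Qed.

Lemma delta_row_r m n (i : 'I_n) :
  delta_mx 0 (rshift m i) = row_mx 0 (delta_mx 0 i) :> 'rV[R]_(m + n).
Proof.
apply/rowP => j; rewrite !mxE; case: split_ordP => l ->; rewrite !mxE.
  by rewrite eq_lrshift.
by rewrite (inj_eq (@rshift_inj _ _)).
Qed.

Lemma row_mx_line m n h (a x : 'rV[R]_m) (b y : 'rV[R]_n) :
  h *: row_mx a b + row_mx x y = row_mx (h *: a + x) (h *: b + y).
Proof. by rewrite scale_row_mx add_row_mx. Qed.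

End RowNorm.

Section Reindex.
Context {R : realType} {n m : nat}.

(** Both exchanging the two groups of variables and freezing one of them are
    instances of this reparametrisation. *)
Lemma bC_reindex (A : 'rV[R]_n -> 'rV[R]_m) (s : 'I_n -> 'I_m) :
  (forall x y, `|A x - A y| <= `|x - y|) ->
  (forall i (h : R) x,
    A (h *: delta_mx 0 i + x) = h *: delta_mx 0 (s i) + A x) ->
  forall k B f, bC k B f -> bC k B (f \o A).
Proof.
move=> A1 As.
have cA : continuous A.
  by apply: (@lip_continuous _ _ _ 1) => x y; rewrite mul1r.
have cfA (f : 'rV[R]_m -> R) : continuous f -> continuous (f \o A).
  by move=> cf x; apply: continuous_comp; [exact: cA | exact: cf].
elim=> [|k IH] B f [cf fB df]; split => //.
- exact: cfA.
- by move=> x; exact: fB.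
- exact: cfA.
- by move=> x; exact: fB.
move=> i; have [d1 d2] := df (s i).
have dA x : is_derive x (delta_mx 0 i) (f \o A) (pderiv (s i) f (A x)).
  have /derivableP/is_derive_along := d1 (A x).
  move=> H; apply: (is_derive_along _ _ _ _).2.
  suff -> : (fun h : R => (f \o A) (h *: delta_mx 0 i + x)) =
    (fun h : R => f (h *: delta_mx 0 (s i) + A x)) by exact: H.
  by apply/funext => h; rewrite /= As.
split; first by move=> x; exact: ex_derive.
have -> : pderiv i (f \o A) = pderiv (s i) f \o A.
  by apply/funext => x; exact: derive_val.
exact: IH.
Qed.

End Reindex.

Section TwoVariables.
Context {R : realType} {d : nat}.
Implicit Types (f : 'rV[R]_(d + d) -> R) (x y : 'rV[R]_d).

Definition swap_rows (z : 'rV[R]_(d + d)) : 'rV[R]_(d + d) :=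
  row_mx (rsubmx z) (lsubmx z).

Lemma swap_rowsE x y : swap_rows (row_mx x y) = row_mx y x.
Proof. by rewrite /swap_rows row_mxKl row_mxKr. Qed.

Lemma bC_swap k B f : bC k B f -> bC k B (f \o swap_rows).
Proof.
apply: (@bC_reindex R _ _ _ (fun i => match fintype.split i with
  inl j => rshift d j | inr j => lshift d j end)).
- move=> z w; rewrite /swap_rows opp_row_mx add_row_mx.
  apply: rV_norm_row_mx; apply: rV_norm_le => // i.
    by have := coord_le_norm (z - w) (rshift d i); rewrite !mxE.
  by have := coord_le_norm (z - w) (lshift d i); rewrite !mxE.
- move=> i h z; rewrite -[z]hsubmxK; case: (split_ordP i) => j ->.
  + rewrite delta_row_l delta_row_r.
    by rewrite row_mx_line !swap_rowsE row_mx_line.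
  + rewrite delta_row_l delta_row_r.
    by rewrite row_mx_line !swap_rowsE row_mx_line.
Qed.

Lemma bC_freeze_l k B f x : bC k B f -> bC k B (fun y => f (row_mx x y)).
Proof.
apply: (@bC_reindex R _ _ (row_mx x) (@rshift d d)).
  move=> y y'; rewrite opp_row_mx add_row_mx subrr.
  by apply: rV_norm_row_mx; rewrite ?normr0.
by move=> i h y; rewrite delta_row_r row_mx_line scaler0 add0r.
Qed.

Lemma bC_freeze_r k B f y : bC k B f -> bC k B (fun x => f (row_mx x y)).
Proof.
apply: (@bC_reindex R _ _ (row_mx^~ y) (@lshift d d)).
  move=> x x'; rewrite opp_row_mx add_row_mx subrr.
  by apply: rV_norm_row_mx; rewrite ?normr0.
by move=> i h x; rewrite delta_row_l row_mx_line scaler0 add0r.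
Qed.

(** Differentiation of [J (f (x, .))] with respect to [x], for a linear form
    [J]. One more derivative than needed is bounded, so that the difference
    quotients converge uniformly, with a linear rate, and no dominated
    convergence is involved. *)
Lemma bC_kernel (J : ('rV[R]_d -> R) -> R) (A0 A : R) :
  (forall a (f g : 'rV[R]_d -> R), continuous f -> continuous g ->
    J (fun y => a * f y + g y) = a * J f + J g) ->
  (forall (B : R) (f : 'rV[R]_d -> R), continuous f ->
    (forall y, `|f y| <= B) -> `|J f| <= A0 * B) ->
  (forall (B : R) (f : 'rV[R]_d -> R), bC 1 B f -> `|J f| <= A * B) ->
  forall k B f, bC k.+1 B f ->
    bC k (A * B) (fun x => J (fun y => f (row_mx x y))).
Proof.
move=> Jlin J0 J1.
have JB (f g : 'rV[R]_d -> R) : continuous f -> continuous g ->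
    J (fun y => f y - g y) = J f - J g.
  move=> cf cg; have := Jlin (-1) _ _ cg cf; rewrite mulN1r addrC => <-.
  by congr J; apply/funext => y; rewrite mulN1r addrC.
have cfr k B f x : bC k B f -> continuous (fun y => f (row_mx x y)).
  by move=> fB; exact: bC_continuous (bC_freeze_l x fB).
have bJ k B f x : bC k.+1 B f -> `|J (fun y => f (row_mx x y))| <= A * B.
  move=> fB; apply: J1; apply: bC_freeze_l.
  by move: fB; apply: bC_sub.
have cJ k B f : bC k.+1 B f -> continuous (fun x => J (fun y => f (row_mx x y))).
  move=> fB; apply: (@lip_continuous _ _ _ (A0 * (d%:R * B))) => x x'.
  rewrite -JB; try exact: cfr fB.
  rewrite -mulrA; apply: J0.
    move=> y; apply: continuousB; exact: (cfr _ _ _ _ fB).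
  by move=> y; exact: (bC_lip (bC_freeze_r y fB)).
elim=> [|k IH] B f fB.
  by split => // [|x]; [exact: cJ fB | exact: bJ fB].
split=> [|x|i]; [exact: cJ fB | exact: bJ fB |].
have [d1 d2] := bC_pderiv (lshift d i) fB.
have dJ x : is_derive x (delta_mx 0 i) (fun x => J (fun y => f (row_mx x y)))
    (J (fun y => pderiv (lshift d i) f (row_mx x y))).
  apply: (@is_derive_quad _ _ _ _ _ _ (A0 * B)) => h h1.
  have rowE y (t : R) : row_mx (t *: delta_mx 0 i + x) y =
      t *: delta_mx 0 (lshift d i) + row_mx x y.
    by rewrite delta_row_l row_mx_line scaler0 add0r.
  have c1 : continuous (fun y => pderiv (lshift d i) f (row_mx x y)) := cfr _ _ _ x d2.
  have c2 : continuous
      (fun y => f (row_mx (h *: delta_mx 0 i + x) y) - f (row_mx x y)).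
    by move=> y; apply: continuousB; exact: (cfr _ _ _ _ fB).
  have -> : J (fun y => f (row_mx (h *: delta_mx 0 i + x) y)) -
      J (fun y => f (row_mx x y)) -
      h * J (fun y => pderiv (lshift d i) f (row_mx x y)) =
    J (fun y => (- h) * pderiv (lshift d i) f (row_mx x y) +
      (f (row_mx (h *: delta_mx 0 i + x) y) - f (row_mx x y))).
    rewrite (Jlin (- h) _ _ c1 c2) JB; try exact: cfr fB.
    by rewrite mulNr addrC.
  rewrite -mulrA; apply: J0.
    move=> y; apply: continuousD (c2 y).
    by apply: continuousM (c1 y); exact: cst_continuous.
  move=> y; rewrite rowE addrC.
  have [|s sh ->] := @MVT_line _ _ f (row_mx x y) (delta_mx 0 (lshift d i)) h.
    by move=> t; exact: d1.
  have [d3 d4] := bC_pderiv (lshift d i) d2.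
  have [|t ts] := @MVT_line _ _ (pderiv (lshift d i) f) (row_mx x y)
    (delta_mx 0 (lshift d i)) s; first by move=> t; exact: d3.
  rewrite mulNr -mulrBr => E; rewrite normrM /pderiv in E *.
  rewrite E normrM; set P := 'D_ _ _ _.
  have PB : `|P| <= B by exact: bC_bound d4.
  rewrite -real_normK ?num_real// expr2 [leRHS]mulrC -mulrA ler_wpM2l//.
  exact: ler_pM.
split; first by move=> x; exact: ex_derive.
suff -> : pderiv i (fun x => J (fun y => f (row_mx x y))) =
    (fun x => J (fun y => pderiv (lshift d i) f (row_mx x y))) by exact: IH.
by apply/funext => x; exact: derive_val.
Qed.

End TwoVariables.

(** * Extensions of finite norm *)

Section Cutoff.
Context {R : realType} {m : nat}.
Implicit Types (f g : 'rV[R]_m -> R) (x : 'rV[R]_m) (i j : 'I_m) (k n : nat).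

Lemma continuous_compact_bounded (V : normedModType R) (f : V -> R) (K : set V) :
  compact K -> continuous f ->
  exists2 B : R, 0 <= B & forall x : V, K x -> `|f x| <= B.
Proof.
move=> cK cf; have : compact (f @` K).
  by apply: continuous_compact => //; exact: continuous_subspaceT.
move=> /compact_bounded[M [_ HM]]; exists (`|M| + 1); first by rewrite addr_ge0.
move=> x Kx; apply: HM; last by exists x.
by rewrite (le_lt_trans (ler_norm M))// ltrDl.
Qed.

Lemma CkM k f g : Ck k f -> Ck k g -> Ck k (f * g).
Proof.
elim: k f g => [f g cf cg x|k IH f g Hf Hg]; first exact: (continuousM (cf x) (cg x)).
have [Hf' Hg'] := (Ck_sub (leqnSn _) Hf, Ck_sub (leqnSn _) Hg).
case: Hf Hg => cf df [cg dg].
split=> [x|i]; first exact: (continuousM (cf x) (cg x)).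
have [df1 df2] := df i; have [dg1 dg2] := dg i.
split; first by move=> x; exact: derivableM.
suff -> : pderiv i (f * g) = f * pderiv i g - (- g) * pderiv i f.
  apply: CkB; apply: IH => //; rewrite -sub0r; apply: CkB => //; exact: (Ck_cst k 0).
by apply/funext => x; rewrite /pderiv deriveM// !fctE mulNr opprK.
Qed.

Lemma CkD k f g : Ck k f -> Ck k g -> Ck k (f + g).
Proof.
move=> Cf Cg; rewrite -[g]opprK; apply: CkB => //; rewrite -sub0r.
by apply: CkB => //; exact: (Ck_cst k 0).
Qed.

(** The square of the positive part is once continuously differentiable, and
    every further factor [t] adds one derivative.  The composition
    1 - ramp (1 - ramp t) is then a step of class C^(n+1), equal to 0 for t <= 0
    and to 1 for t >= 1. *)
Definition ramp n (t : R) : R := t ^+ n * Num.max t 0 ^+ 2.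

Lemma rampP n t : t <= 0 -> ramp n t = 0.
Proof. by move=> t0; rewrite /ramp max_r// expr0n mulr0. Qed.

Lemma ramp1 n : ramp n 1 = 1.
Proof. by rewrite /ramp max_l ?ler01// !expr1n mulr1. Qed.

Lemma ramp_ge1 n t : 1 <= t -> 1 <= ramp n t.
Proof.
move=> t1; rewrite /ramp max_l ?(le_trans ler01)//.
by rewrite -exprD exprn_ege1.
Qed.

Lemma is_derive_ramp0 (t : R) : is_derive t 1 (ramp 0) (2 * Num.max t 0).
Proof.
apply: (@is_derive_quad _ _ _ _ _ _ 1) => h _.
rewrite /ramp !expr0 !mul1r [_%:A]mulr1 ler_norml.
have [a|a] := leP (h + t) 0; have [b|b] := leP t 0; apply/andP; split; nra.
Qed.

Lemma is_derive_rampS n (t : R) :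
  is_derive t 1 (ramp n.+1) (n.+3%:R * ramp n t).
Proof.
have : is_derive t 1 (ramp n.+1) 
    (t ^+ n.+1 *: (2 * Num.max t 0) + ramp 0 t *: (n.+1%:R * t ^+ n)).
  have -> : ramp n.+1 = (fun t : R => t ^+ n.+1) * ramp 0.
    by apply/funext => s; rewrite /ramp !fctE expr0 mul1r.
  apply: is_deriveM; last exact: is_derive_ramp0.
  apply: DeriveDef; first exact: exprn_derivable.
  by rewrite exp_derive /GRing.scale/= mulr1.
move=> H; apply: is_derive_eq H _.
rewrite /GRing.scale/= /ramp expr0 mul1r.
have [t0|t0] := leP t 0.
  by rewrite expr0n/= !mulr0 mul0r addr0.
rewrite -(natr1 n.+2) -(natr1 n.+1) !(exprS t); ring.
Qed.

Lemma Ck_ramp n f : Ck n.+1 f -> Ck n.+1 (ramp n \o f).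
Proof.
elim: n f => [|n IH] f Hf.
  case: Hf => cf df.
  have dr i x : is_derive x (delta_mx 0 i) (ramp 0 \o f)
      (2 * Num.max (f x) 0 * pderiv i f x).
    by apply: is_derive_comp1; [exact: (df i).1 | exact: is_derive_ramp0].
  have cmax : continuous (fun x => Num.max (f x) 0).
    move=> x; apply: (@continuous_max _ _ f (cst 0)). exact: cf.
    exact: (@cst_continuous _ _ (0 : R)).
  split.
    move=> x; apply: continuous_comp; first exact: cf.
    apply/differentiable_continuous/derivable1_diffP.
    by have := is_derive_ramp0 (f x) => ?; exact: ex_derive.
  move=> i; split; first by move=> x; exact: ex_derive.
  have -> : pderiv i (ramp 0 \o f) = (fun x => 2 * Num.max (f x) 0 * pderiv i f x).
    by apply/funext => x; exact: derive_val.
  have c2 : continuous (fun x => 2 * Num.max (f x) 0).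
    by move=> x; apply: (continuousM _ (cmax x)); exact: (@cst_continuous _ _ (2 : R)).
  by move=> x; exact: (continuousM (c2 x) ((df i).2 x)).
have Cr := IH _ (Ck_sub (leqnSn _) Hf).
case: Hf => cf df.
have dr i x : is_derive x (delta_mx 0 i) (ramp n.+1 \o f)
    (n.+3%:R * ramp n (f x) * pderiv i f x).
  by apply: is_derive_comp1; [exact: (df i).1 | exact: is_derive_rampS].
split.
  move=> x; apply: continuous_comp; first exact: cf.
  apply/differentiable_continuous/derivable1_diffP.
  by have := is_derive_rampS n (f x) => ?; exact: ex_derive.
move=> i; split; first by move=> x; exact: ex_derive.
have -> : pderiv i (ramp n.+1 \o f) =
    cst n.+3%:R * (ramp n \o f) * pderiv i f.
  by apply/funext => x; exact: derive_val.
by apply: CkM; [apply: CkM => //; exact: Ck_cst | exact: (df i).2].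
Qed.

Lemma Ck_coord k i : Ck k (fun x => x 0 i).
Proof.
case: k => [|k]; first by move=> x; exact: coord_continuous.
split; first by move=> x; exact: coord_continuous.
move=> j.
have dc x : is_derive x (delta_mx 0 j) (fun x : 'rV[R]_m => x 0 i) (i == j)%:R.
  apply: (@is_derive_quad _ _ _ _ _ _ 0) => h _.
  by rewrite !mxE /= addrK subrr normr0 mul0r.
split; first by move=> x; exact: ex_derive.
have -> : pderiv j (fun x : 'rV[R]_m => x 0 i) = cst (i == j)%:R.
  by apply/funext => x; exact: derive_val.
exact: Ck_cst.
Qed.

Definition sqnorm x := \sum_i x 0 i ^+ 2.

Lemma Ck_sqnorm k : Ck k sqnorm.
Proof.
have -> : sqnorm = \sum_i ((fun x => x 0 i) * (fun x => x 0 i)).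
  by apply/funext => x; rewrite fct_sumE; apply: eq_bigr => i _; rewrite expr2.
apply: (big_ind (Ck k)); first exact: (Ck_cst k 0).
  exact: CkD.
by move=> i _; apply: CkM; exact: Ck_coord.
Qed.

Lemma sqr_norm_le_sqnorm x : `|x| ^+ 2 <= sqnorm x.
Proof.
rewrite -[leRHS]sqr_sqrtr ?sumr_ge0// => [|i _]; last exact: sqr_ge0.
rewrite ler_sqr ?nnegrE ?sqrtr_ge0//; apply: rV_norm_le => [|i].
  exact: sqrtr_ge0.
rewrite -sqrtr_sqr ler_sqrt ?sumr_ge0// => [|j _]; last exact: sqr_ge0.
by rewrite /sqnorm (bigD1 i)//= lerDl sumr_ge0// => j _; exact: sqr_ge0.
Qed.

Lemma bC_compact_support k f (r : R) : Ck k f ->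
  (forall x, r < `|x| -> f x = 0) -> exists B, bC k B f.
Proof.
have cQ : compact [set x : 'rV[R]_m | `|x| <= r].
  apply: bounded_closed_compact.
    exists r; split; first exact: num_real.
    by move=> t rt x /= xr; exact: le_trans xr (ltW rt).
  apply: (@closed_comp _ _ (fun x : 'rV[R]_m => `|x|) [set t : R | t <= r]).
    by move=> x _; exact: norm_continuous.
  exact: closed_le.
have bd g : continuous g -> (forall x, r < `|x| -> g x = 0) ->
    exists2 B, 0 <= B & forall x, `|g x| <= B.
  move=> cg g0; have [B B0 gB] := continuous_compact_bounded cQ cg.
  exists B => // x; have [xr|/g0 ->] := leP `|x| r; first exact: gB.
  by rewrite normr0.
elim: k f => [|k IH] f Cf f0.
  by have [B _ fB] := bd f Cf f0; exists B.
case: Cf => cf df; have [B B0 fB] := bd f cf f0.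
have /choice[Bi HBi] : forall i, exists Bi, bC k Bi (pderiv i f).
  move=> i; apply: IH; first exact: (df i).2.
  move=> x rx; rewrite /pderiv -(derive_cst (W := R) 0 x (delta_mx 0 i)).
  apply: near_eq_derive.
  have : \forall y \near x, r < `|y|.
    exact: (@norm_continuous _ _ x _ (lt_nbhsr rx)).
  by apply: filterS => y /f0.
exists (B + \sum_i Bi i); split => //.
  move=> x; apply: le_trans (fB x) _; rewrite lerDl sumr_ge0// => i _.
  exact: bC_ge0 (HBi i).
move=> i; split; first exact: (df i).1.
apply: bC_le (HBi i); rewrite (bigD1 i)//= addrCA lerDl addr_ge0// sumr_ge0// => j _.
exact: bC_ge0 (HBi j).
Qed.

(** An arbitrary extension may have unbounded derivatives; its product with a
    cutoff is an extension with compact support. *)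
Lemma Ck_norm_lt_pinfty k (K : set 'rV[R]_m) f : compact K ->
  f \in Ck_on k K -> (Ck_norm k K f < +oo)%E.
Proof.
move=> cK /asboolP[g [Cg gf]].
have [N N0 KN] := continuous_compact_bounded cK (Ck_sqnorm 0).
pose chi := cst 1 - (ramp k \o (cst 1 - (ramp k \o (cst (N + 1) - sqnorm)))).
have Cchi : Ck k chi.
  apply: (@Ck_sub _ _ k k.+1) => //; apply: CkB; first exact: Ck_cst.
  apply: Ck_ramp; apply: CkB; first exact: Ck_cst.
  by apply: Ck_ramp; apply: CkB; [exact: Ck_cst | exact: Ck_sqnorm].
have chi1 x : K x -> chi x = 1.
  move=> /KN xN; rewrite -[LHS]/(1 - ramp k (1 - ramp k (N + 1 - sqnorm x))).
  have r1 : 1 <= ramp k (N + 1 - sqnorm x).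
    by apply: ramp_ge1; have := le_trans (ler_norm _) xN; lra.
  by rewrite (@rampP k (1 - _)) ?subr0// subr_le0.
have chi0 x : N + 1 < `|x| -> chi x = 0.
  move=> xN; rewrite -[LHS]/(1 - ramp k (1 - ramp k (N + 1 - sqnorm x))).
  have r0 : N + 1 - sqnorm x <= 0.
    rewrite subr_le0 (le_trans (ltW xN))// (le_trans _ (sqr_norm_le_sqnorm x))//.
    by rewrite expr2 ler_peMr// (le_trans _ (ltW xN))// lerDr.
  by rewrite (rampP k r0) subr0 ramp1 subrr.
have [B gB] : exists B, bC k B (g * chi).
  apply: (@bC_compact_support _ _ (N + 1)); first exact: CkM.
  by move=> x /chi0 c0; rewrite fctE c0 mulr0.
apply: le_lt_trans (ltry B); apply: le_trans (norm_of_bC gB).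
apply: ereal_inf_lbound; exists (g * chi) => //; split; first exact: CkM.
by move=> x xK; rewrite fctE chi1 ?mulr1 ?gf//; exact: set_mem.
Qed.

End Cutoff.

(** * Normalised positive functionals *)

Section States.
Context {R : realType} {V : normedModType R}.
Implicit Types (X : set V) (f g : V -> R) (I J : (V -> R) -> R).

(** What is used of the integral against a probability measure carried by [X].
    Testing positivity on [X] only expresses that the measure is carried by [X]. *)
Definition state X I :=
  [/\ I (cst 1) = 1,
      forall a f g, continuous f -> continuous g ->
        I (fun y => a * f y + g y) = a * I f + I g
    & forall f, continuous f -> (forall x, X x -> 0 <= f x) -> 0 <= I f].

Lemma continuous_cst (a : R) : continuous (fun _ : V => a).
Proof. exact: cst_continuous. Qed.

Section OneState.
Context {X : set V} {I : (V -> R) -> R} (SI : state X I).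

Lemma state_lin a f g : continuous f -> continuous g ->
  I (fun y => a * f y + g y) = a * I f + I g.
Proof. by case: SI => _ + _; exact. Qed.

Lemma state_cst a : I (fun=> a) = a.
Proof.
have c1 := @continuous_cst 1; have c0 := @continuous_cst 0.
have I0 : I (fun=> 0) = 0.
  have E : I (fun=> 0) = 1 * I (fun=> 0) + I (fun=> 0).
    rewrite -(state_lin 1 c0 c0); congr I.
    by apply/funext => y; rewrite mulr0 addr0.
  by move: E; rewrite mul1r => E; apply: (@addIr _ (I (fun=> 0))); rewrite add0r -E.
have E : I (fun=> a) = a * I (fun=> 1) + I (fun=> 0).
  rewrite -(state_lin a c1 c0); congr I.
  by apply/funext => y; rewrite mulr1 addr0.
have [I1 _ _] := SI; rewrite E I0 addr0.
by have -> : I (fun=> 1) = 1 by []; rewrite mulr1.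
Qed.

Lemma stateZ a f : continuous f -> I (fun y => a * f y) = a * I f.
Proof.
move=> cf; have := state_lin a cf (@continuous_cst 0).
by rewrite state_cst addr0 => <-; congr I; apply/funext => y; rewrite addr0.
Qed.

Lemma stateB f g : continuous f -> continuous g ->
  I (fun y => f y - g y) = I f - I g.
Proof.
move=> cf cg; have := state_lin (-1) cg cf; rewrite mulN1r addrC => <-.
by congr I; apply/funext => y; rewrite mulN1r addrC.
Qed.

Lemma state_le f g : continuous f -> continuous g ->
  (forall x, X x -> f x <= g x) -> I f <= I g.
Proof.
move=> cf cg fg; rewrite -subr_ge0 -stateB//; case: SI => _ _; apply.
  by move=> x; apply: continuousB; [exact: cg | exact: cf].
by move=> x /fg; rewrite subr_ge0.
Qed.

Lemma state_norm_le f B : continuous f -> (forall x, X x -> `|f x| <= B) ->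
  `|I f| <= B.
Proof.
move=> cf fB; rewrite ler_norml -{1}(state_cst (- B)) -{2}(state_cst B).
by rewrite !state_le//; try exact: continuous_cst;
  move=> x /fB; rewrite ler_norml => /andP[].
Qed.

Lemma continuous_sum (T : Type) (s : seq T) (F : T -> V -> R) :
  (forall t, continuous (F t)) -> continuous (fun x => \sum_(t <- s) F t x).
Proof.
move=> cF; elim: s => [|t s IH].
  under eq_fun do rewrite big_nil; exact: continuous_cst.
under eq_fun do rewrite big_cons; move=> x.
by apply: continuousD; [exact: cF | exact: IH].
Qed.

Lemma state_sum (T : Type) (s : seq T) (F : T -> V -> R) :
  (forall t, continuous (F t)) ->
  I (fun x => \sum_(t <- s) F t x) = \sum_(t <- s) I (F t).
Proof.
move=> cF; elim: s => [|t s IH].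
  by rewrite big_nil -[RHS]state_cst; congr I; apply/funext => x; rewrite big_nil.
rewrite big_cons -IH -[I (F t)]mul1r -state_lin//; last exact: continuous_sum.
by congr I; apply/funext => x; rewrite big_cons mul1r.
Qed.

(** The weights are the values of the functional on a partition of unity
    subordinate to small balls; the nodes and weights serve all functions with
    the same Lipschitz constant at once. *)
Lemma state_quadrature (e : R) : compact X -> 0 < e ->
  exists s : seq (R * V), forall L f, 0 <= L -> lip L f ->
    `|I f - \sum_(p <- s) p.1 * f p.2| <= L * e.
Proof.
move=> cX e0; pose r := e / 2; have r0 : 0 < r by rewrite divr_gt0.
have [s Xs] : exists s : seq V, forall x, X x -> exists2 q, q \in s & `|x - q| < r.
  move: (cX); rewrite compact_cover => /(_ V X (fun q => ball q r)).
  case => [q _|x Xx|D _ XD]; first exact: ball_open.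
    by exists x => //; exact: ballxx.
  exists (finmap.enum_fset D) => x /XD[q /= qD]; rewrite -ball_normE/= distrC => xq.
  by exists q.
pose psi (q x : V) : R := Num.max (e - `|x - q|) 0.
have cpsi q : continuous (psi q).
  move=> x; apply: (@continuous_max _ _ (fun x => e - `|x - q|) (cst 0)).
    apply: continuousB; first exact: continuous_cst.
    apply: (@continuous_comp _ _ _ (fun x => x - q)); last exact: norm_continuous.
    by apply: continuousB; [exact: cvg_id | exact: cst_continuous].
  exact: continuous_cst.
pose S (x : V) : R := Num.max (\sum_(q <- s) psi q x) r.
have S0 x : 0 < S x by rewrite /S lt_max r0 orbT.
have cS : continuous S.
  move=> x; apply: (@continuous_max _ _ _ (cst r)); last exact: continuous_cst.
  exact: continuous_sum.
pose chi (q x : V) : R := psi q x / S x.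
have cchi q : continuous (chi q).
  move=> x; apply: continuousM; first exact: cpsi.
  by apply: continuousV; [rewrite gt_eqF | exact: cS].
have psi0 q x : 0 <= psi q x by rewrite /psi le_max lexx orbT.
have sum1 x : X x -> \sum_(q <- s) chi q x = 1.
  move=> /Xs[q qs xq]; rewrite -mulr_suml.
  have SE : S x = \sum_(q <- s) psi q x.
    rewrite /S max_l//; rewrite (big_rem q)//=.
    apply: (@le_trans _ _ (psi q x)); last by rewrite lerDl sumr_ge0.
    rewrite /psi le_max; apply/orP; left; move: xq.
    have -> : e = r + r by rewrite /r -splitr.
    by lra.
  by rewrite -SE divff// gt_eqF.
exists [seq (I (chi q), q) | q <- s] => L f L0 fL.
have cf := lip_continuous fL.
rewrite big_map /=; have -> : \sum_(q <- s) I (chi q) * f q =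
    I (fun x => \sum_(q <- s) f q * chi q x).
  rewrite state_sum.
    by apply: eq_bigr => q _; rewrite stateZ// mulrC.
  by move=> q x; apply: continuousM; [exact: continuous_cst | exact: cchi].
have csum : continuous (fun x => \sum_(q <- s) f q * chi q x).
  apply: continuous_sum => q x.
  by apply: continuousM; [exact: continuous_cst | exact: cchi].
rewrite -stateB//; apply: state_norm_le => [x|x Xx].
  by apply: continuousB; [exact: cf | exact: csum].
rewrite -{1}[f x]mulr1 -(sum1 x Xx) mulr_sumr -sumrB.
apply: le_trans (ler_norm_sum _ _ _) _.
rewrite -[leRHS]mulr1 -(sum1 x Xx) mulr_sumr; apply: ler_sum => q _.
have chi0 : 0 <= chi q x by rewrite divr_ge0// ltW.
rewrite -mulrBl normrM (ger0_norm chi0).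
have [xq|qx] := ltP `|x - q| e.
  by rewrite ler_wpM2r// (le_trans (fL _ _))// ler_wpM2l// ltW.
suff -> : chi q x = 0 by rewrite !mulr0.
by rewrite /chi /psi max_r ?mul0r// subr_le0.
Qed.

End OneState.

(** By quadrature [I] is nearly a finite combination of evaluations, with which
    [J] commutes by linearity. *)
Lemma state_Fubini X Y I J (L : R) (h : V -> V -> R) :
  compact X -> state X I -> state Y J -> 0 <= L ->
  (forall y, lip L (h^~ y)) -> (forall x, lip L (h x)) ->
  I (fun x => J (h x)) = J (fun y => I (h^~ y)).
Proof.
move=> cX SI SJ L0 hl hr.
have cl y := lip_continuous (hl y); have cr x := lip_continuous (hr x).
have lJ : lip L (fun x => J (h x)).
  move=> x x'; rewrite -(stateB SJ)//; apply: (state_norm_le SJ).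
    by move=> y; apply: continuousB; exact: cr.
  by move=> y _; exact: hl.
have lI : lip L (fun y => I (h^~ y)).
  move=> y y'; rewrite -(stateB SI)//; apply: (state_norm_le SI).
    by move=> x; apply: continuousB; exact: cl.
  by move=> x _; exact: hr.
apply/eqP; rewrite -subr_eq0 -normr_eq0 eq_le normr_ge0 andbT.
apply/ler_addgt0Pl => e e0; rewrite addr0.
have L1 : 0 < L + 1 by rewrite ltr_wpDl.
have [s Hs] := state_quadrature SI cX (divr_gt0 (divr_gt0 e0 L1) (ltr0Sn R 1)).
have E1 := Hs _ _ L0 lJ.
have csum : continuous (fun y => \sum_(p <- s) p.1 * h p.2 y).
  by apply: continuous_sum => p y; exact: (continuousM (@continuous_cst p.1 y) (cr p.2 y)).
have E2 : `|J (fun y => I (h^~ y)) - \sum_(p <- s) p.1 * J (h p.2)| <=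
    L * (e / (L + 1) / 2).
  have -> : \sum_(p <- s) p.1 * J (h p.2) = J (fun y => \sum_(p <- s) p.1 * h p.2 y).
    rewrite (state_sum SJ).
      by apply: eq_bigr => p _; rewrite (stateZ SJ).
    by move=> p y; exact: (continuousM (@continuous_cst p.1 y) (cr p.2 y)).
  rewrite -(stateB SJ)//; last exact: lip_continuous lI.
  apply: (state_norm_le SJ).
    by move=> y; apply: continuousB; [exact: (lip_continuous lI) | exact: csum].
  by move=> y _; exact: Hs.
apply: le_trans (ler_distD (\sum_(p <- s) p.1 * J (h p.2)) _ _) _.
rewrite (distrC _ (J _)); apply: le_trans (lerD E1 E2) _.
rewrite -mulrDr -splitr mulrCA ler_piMr ?(ltW e0)//.
by rewrite ler_pdivrMr// mul1r lerDl.
Qed.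

End States.

(** * The Schrödinger transform *)

Section RealInequalities.
Context {R : realType}.
Implicit Types a b c e : R.

Lemma expR_diff_le a b c : a <= c -> b <= c ->
  `|expR a - expR b| <= expR c * `|a - b|.
Proof.
wlog ba : a b / b <= a => [H ac bc|ac bc].
  have [ba|/ltW ab] := leP b a; first exact: H.
  by rewrite distrC (distrC a) H.
rewrite !ger0_norm ?subr_ge0 ?ler_expR//.
apply: (@le_trans _ _ (expR a * (a - b))); last first.
  by rewrite ler_wpM2r ?subr_ge0// ler_expR.
have -> : expR b = expR a * expR (b - a) by rewrite -expRD addrC subrK.
rewrite -{1}[expR a]mulr1 -mulrBr ler_wpM2l ?expR_ge0//.
by have := expR_ge1Dx (b - a); lra.
Qed.

(** Convexity of the exponential on the segment from 0 to [b]. *)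
Lemma expR_convex0 e b : 0 <= e <= 1 -> expR (e * b) <= e * expR b + (1 - e).
Proof.
move=> /andP[e0 e1].
have E1 : expR b = expR (e * b) * expR ((1 - e) * b).
  by rewrite -expRD; congr expR; ring.
have E2 : 1 = expR (e * b) * expR (- (e * b)) by rewrite -expRD subrr expR0.
have Hv := expR_ge1Dx ((1 - e) * b); have Hw := expR_ge1Dx (- (e * b)).
rewrite E1 -[X in _ + X]mulr1 [X in _ + _ * X]E2.
move: Hv Hw; set u := expR (e * b); set v := expR ((1 - e) * b); set w := expR (- (e * b)).
move=> Hv Hw; have u0 : 0 <= u by exact: expR_ge0.
have K1 : e * u * (1 + (1 - e) * b) <= e * u * v by rewrite ler_wpM2l// mulr_ge0.
have K2 : (1 - e) * u * (1 + - (e * b)) <= (1 - e) * u * w.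
  by rewrite ler_wpM2l// mulr_ge0// subr_ge0.
rewrite !mulrA; apply: le_trans (lerD K1 K2).
by rewrite le_eqVlt; apply/orP; left; apply/eqP; ring.
Qed.

End RealInequalities.

Section Transform.
Context {R : realType} {V : normedModType R}.
Implicit Types (X : set V) (phi psi : V -> R) (I : (V -> R) -> R)
  (kap : V -> V -> R).

Definition bounded_by (B : R) (f : V -> R) := forall x, `|f x| <= B.

(** The soft c-transform: [phi1] and [phi2] solve the Schrödinger system when
    they are transforms of each other. *)
Definition stransform I kap phi (x : V) : R :=
  - ln (I (fun y => expR (phi y - kap x y))).

Definition good_cost (M L : R) kap :=
  [/\ 0 <= L, forall x y, `|kap x y| <= M,
      forall x, lip L (kap x) & forall y, lip L (kap^~ y)].

Lemma good_costT M L kap : good_cost M L kap -> good_cost M L (fun x y => kap y x).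
Proof. by case=> L0 kM k1 k2; split => //. Qed.

Lemma lip_expR (C Q : R) (f : V -> R) : lip Q f -> (forall x, f x <= C) ->
  lip (expR C * Q) (fun x => expR (f x)).
Proof.
move=> fQ fC x y; apply: le_trans (expR_diff_le (fC x) (fC y)) _.
by rewrite -mulrA ler_wpM2l ?expR_ge0//; exact: fQ.
Qed.

Lemma lipB (L Q : R) (f g : V -> R) : lip L f -> lip Q g ->
  lip (L + Q) (fun x => f x - g x).
Proof.
move=> fL gQ x y; rewrite opprD addrACA -opprD mulrDl.
by apply: le_trans (ler_normB _ _) _; apply: lerD.
Qed.

Lemma continuous_scale (a : R) (f : V -> R) : continuous f ->
  continuous (fun y : V => a * f y).
Proof. by move=> cf y; exact: (continuousM (@continuous_cst _ _ a y) (cf y)). Qed.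

Lemma continuous_sub (f g : V -> R) : continuous f -> continuous g ->
  continuous (fun y : V => f y - g y).
Proof. by move=> cf cg y; exact: (continuousB (cf y) (cg y)). Qed.

Section OneTransform.
Context {X : set V} {I : (V -> R) -> R} (SI : state X I).
Context {M L : R} {kap : V -> V -> R} (Gk : good_cost M L kap).
Local Notation T := (stransform I kap).

Lemma continuous_integrand phi x : continuous phi ->
  continuous (fun y => expR (phi y - kap x y)).
Proof.
move=> cp y; apply: (@continuous_comp _ _ _ (fun y => phi y - kap x y)).
  apply: continuousB; first exact: cp.
  by case: Gk => _ _ k1 _; exact: lip_continuous (k1 x) y.
exact: continuous_expR.
Qed.

Lemma integrand_bounds P phi x y : bounded_by P phi ->
  expR (- (P + M)) <= expR (phi y - kap x y) <= expR (P + M).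
Proof.
move=> pP; rewrite !ler_expR; have := pP y; case: Gk => _ /(_ x y) + _ _.
by rewrite !ler_norml => /andP[? ?] /andP[? ?]; apply/andP; split; lra.
Qed.

Lemma state_integrand P phi x : continuous phi -> bounded_by P phi ->
  expR (- (P + M)) <= I (fun y => expR (phi y - kap x y)) <= expR (P + M).
Proof.
move=> cp pP; rewrite -{1}(state_cst SI (expR (- _))) -(state_cst SI (expR (P + M))).
have cc (a : R) : continuous (fun _ : V => a) by exact: continuous_cst.
by apply/andP; split; apply: (state_le SI) => //;
  [exact: continuous_integrand | | exact: continuous_integrand |] => y _;
  case/andP: (integrand_bounds x y pP).
Qed.

Lemma state_integrand_gt0 P phi x : continuous phi -> bounded_by P phi ->
  0 < I (fun y => expR (phi y - kap x y)).
Proof.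
move=> cp pP; apply: lt_le_trans (expR_gt0 (- (P + M))) _.
by case/andP: (state_integrand x cp pP).
Qed.

Lemma expR_stransform P phi x : continuous phi -> bounded_by P phi ->
  expR (- T phi x) = I (fun y => expR (phi y - kap x y)).
Proof.
by move=> cp pP; rewrite opprK lnK// posrE (state_integrand_gt0 _ cp pP).
Qed.

Lemma stransform_bounded P phi : continuous phi -> bounded_by P phi ->
  bounded_by (P + M) (T phi).
Proof.
move=> cp pP x; rewrite normrN ler_norml.
have Z0 := state_integrand_gt0 x cp pP.
have /andP[a b] := state_integrand x cp pP.
by apply/andP; split; rewrite -ler_expR lnK// posrE.
Qed.

(** Comparing integrands at two points, up to a constant, yields the Lipschitz,
    oscillation and uniform estimates at once. *)
Lemma stransform_le P phi psi x x' (a : R) :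
  continuous phi -> continuous psi -> bounded_by P phi -> bounded_by P psi ->
  (forall y, phi y - kap x y <= psi y - kap x' y + a) ->
  T psi x' <= T phi x + a.
Proof.
move=> cp cq pP qP H.
have Z0 := state_integrand_gt0 x cp pP; have Z1 := state_integrand_gt0 x' cq qP.
suff : ln (I (fun y => expR (phi y - kap x y))) <=
    ln (I (fun y => expR (psi y - kap x' y))) + a by rewrite /stransform; lra.
rewrite -ler_expR expRD !lnK ?posrE// mulrC -(stateZ SI); last exact: continuous_integrand.
apply: (state_le SI); first exact: continuous_integrand.
  exact/continuous_scale/continuous_integrand.
by move=> y _; rewrite -expRD ler_expR; have := H y; lra.
Qed.

Lemma stransform_lip P phi : continuous phi -> bounded_by P phi ->
  lip L (T phi).
Proof.
move=> cp pP; have [_ _ _ k2] := Gk.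
have H x x' : T phi x' <= T phi x + L * `|x - x'|.
  apply: (stransform_le cp cp pP pP) => y.
  by have := k2 y x' x; rewrite /= distrC ler_norml => /andP[]; rewrite (distrC x'); lra.
move=> x x'; have := H x x'; have := H x' x.
by rewrite (distrC x' x) ler_norml => ? ?; apply/andP; split; lra.
Qed.

Lemma stransform_osc P phi x x' : continuous phi -> bounded_by P phi ->
  T phi x' - T phi x <= 2 * M.
Proof.
move=> cp pP; suff : T phi x' <= T phi x + 2 * M by lra.
apply: (stransform_le cp cp pP pP) => y; have [_ kM _ _] := Gk.
by have := kM x y; have := kM x' y; rewrite !ler_norml => /andP[? ?] /andP[? ?]; lra.
Qed.

Lemma stransform_sup P phi psi D : continuous phi -> continuous psi ->
  bounded_by P phi -> bounded_by P psi ->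
  (forall y, `|phi y - psi y| <= D) -> forall x, `|T phi x - T psi x| <= D.
Proof.
move=> cp cq pP qP H x.
have H1 : T psi x <= T phi x + D.
  apply: (stransform_le cp cq pP qP) => y.
  by have := H y; rewrite ler_norml => /andP[]; lra.
have H2 : T phi x <= T psi x + D.
  apply: (stransform_le cq cp qP pP) => y.
  by have := H y; rewrite ler_norml => /andP[]; lra.
by rewrite ler_norml; apply/andP; split; lra.
Qed.

Lemma stransform_shift P phi a x : continuous phi -> bounded_by P phi ->
  T (fun y => phi y + a) x = T phi x - a.
Proof.
move=> cp pP; have Z0 := state_integrand_gt0 x cp pP.
rewrite /stransform -opprD; congr (- _); rewrite -[X in _ + X]expRK -lnM ?posrE ?expR_gt0//.
congr ln; rewrite mulrC -(stateZ SI); last exact: continuous_integrand.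
by congr I; apply/funext => y; rewrite -expRD; congr expR; ring.
Qed.

(** The probability densities proportional to [expR (psi - kap x)], for varying
    [x], have ratios at least [expR (- 4 * M)]; hence the averages of
    [expR (phi - psi)] against any two of them share this fraction of their
    mass, and the oscillation shrinks by the complementary factor. *)
Lemma stransform_contraction P phi psi D : continuous phi -> continuous psi ->
  bounded_by P phi -> bounded_by P psi ->
  (forall y y', (phi y - psi y) - (phi y' - psi y') <= D) ->
  forall x x', (T phi x - T psi x) - (T phi x' - T psi x') <=
    (1 - expR (- (4 * M))) * D.
Proof.
move=> cp cq pP qP H x x'.
pose u y := phi y - psi y; pose m := inf (range u).
have hi : has_inf (range u).
  split; first by exists (u 0), 0.
  exists (u 0 - D) => _ [y _ <-]; have := H 0 y; rewrite /u; lra.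
have mu y : m <= u y by apply: ge_inf; [exact: hi.2 | exists y].
have um y : u y <= m + D.
  rewrite -lerBlDr; apply: lb_le_inf; first by exists (u 0), 0.
  by move=> _ [y' _ <-]; have := H y y'; rewrite /u; lra.
have M0 : 0 <= M by have [_ /(_ 0 0) + _ _] := Gk; exact: le_trans.
pose N x := I (fun y => expR (phi y - kap x y)).
pose Z x := I (fun y => expR (psi y - kap x y)).
have N0 z : 0 < N z := state_integrand_gt0 z cp pP.
have Z0 z : 0 < Z z := state_integrand_gt0 z cq qP.
have [cN cZ] : (forall z, continuous (fun y => expR (phi y - kap z y))) /\
    (forall z, continuous (fun y => expR (psi y - kap z y))).
  by split => z; exact: continuous_integrand.
have kk y z z' : - kap z y <= - kap z' y + 2 * M.
  have [_ kM _ _] := Gk; have := kM z y; have := kM z' y.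
  by rewrite !ler_norml => /andP[? ?] /andP[? ?]; lra.
have ZZ : Z x <= expR (2 * M) * Z x'.
  rewrite -(stateZ SI)//; apply: (state_le SI) => //.
    exact: continuous_scale.
  by move=> y _; rewrite -expRD ler_expR; have := kk y x x'; lra.
have NZ z : N z - expR m * Z z =
    I (fun y => expR (phi y - kap z y) - expR m * expR (psi y - kap z y)).
  rewrite (stateB SI)//; last first.
    exact: continuous_scale.
  by rewrite (stateZ SI).
have cNZ z : continuous
    (fun y => expR (phi y - kap z y) - expR m * expR (psi y - kap z y)).
  by apply: continuous_sub => //; exact: continuous_scale.
have factor z y : expR (phi y - kap z y) - expR m * expR (psi y - kap z y) =
    (expR (phi y) - expR (m + psi y)) * expR (- kap z y).
  by rewrite !expRD mulrBl mulrA.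
have fac0 y : 0 <= expR (phi y) - expR (m + psi y).
  by rewrite subr_ge0 ler_expR; have := mu y; rewrite /u; lra.
have NN : expR (- (2 * M)) * (N x' - expR m * Z x') <= N x - expR m * Z x.
  rewrite !NZ -(stateZ SI)//; apply: (state_le SI) => //.
    exact: continuous_scale.
  move=> y _; rewrite (factor x' y) (factor x y) mulrCA ler_wpM2l// -expRD ler_expR.
  by have := kk y x' x; lra.
have NZ0 : 0 <= N x' - expR m * Z x'.
  rewrite NZ; case: SI => _ _; apply => // y _.
  by rewrite factor mulr_ge0 ?expR_ge0.
pose e := expR (- (4 * M)).
have e01 : 0 <= e <= 1 by rewrite expR_ge0/= -[leRHS]expR0 ler_expR; lra.
pose b := ln (N x' / Z x') - m.
have Eb : expR b = N x' / Z x' / expR m.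
  by rewrite expRD expRN lnK// posrE divr_gt0.
have b0 : 0 <= b.
  rewrite -ler_expR expR0 Eb ler_pdivlMr ?expR_gt0// mul1r ler_pdivlMr//.
  by rewrite -subr_ge0.
have bD : b <= D.
  rewrite -ler_expR Eb ler_pdivrMr ?expR_gt0// ler_pdivrMr// -expRD.
  rewrite -(stateZ SI)//; apply: (state_le SI) => //.
    exact: continuous_scale.
  by move=> y _; rewrite -expRD ler_expR; have := um y; rewrite /u; lra.
(* The average of [expR u] at [x] is at least the fraction [e] of the average at
   [x'], completed by the least value [expR m]; convexity then bounds it below. *)
have key : expR (m + e * b) <= N x / Z x.
  apply: (@le_trans _ _ (expR m * (e * expR b + (1 - e)))).
    by rewrite expRD ler_wpM2l ?expR_ge0// expR_convex0.
  rewrite ler_pdivlMr// Eb.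
  have -> : expR m * (e * (N x' / Z x' / expR m) + (1 - e)) * Z x =
      expR m * Z x + e * (Z x / Z x') * (N x' - expR m * Z x').
    by field; rewrite !gt_eqF// expR_gt0.
  rewrite -lerBrDl; apply: le_trans NN; rewrite ler_wpM2r//.
  rewrite -[leRHS](_ : e * expR (2 * M) = _); last first.
    by rewrite /e -expRD; congr expR; ring.
  by rewrite ler_wpM2l ?expR_ge0// ler_pdivrMr.
have TE z : T phi z - T psi z = - ln (N z / Z z).
  by rewrite ln_div ?posrE// opprB addrC /stransform opprK.
rewrite !TE opprK.
have key' : m + e * b <= ln (N x / Z x).
  by rewrite -ler_expR lnK ?posrE ?divr_gt0.
have -> : ln (N x' / Z x') = m + b by rewrite /b; ring.
apply: (@le_trans _ _ ((1 - e) * b)); first by rewrite mulrBl mul1r; lra.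
by rewrite ler_wpM2l// subr_ge0; case/andP: e01.
Qed.

End OneTransform.

(** The dual form of the Wasserstein distance of order 1, which is all that the
    estimates need. *)
Definition dual_close (w : R) I I' := forall Q B f,
  0 <= Q -> lip Q f -> bounded_by B f -> `|I f - I' f| <= Q * w.

Lemma stransform_stable X X' I I' M L kap P Q w phi x :
  state X I -> state X' I' -> good_cost M L kap -> dual_close w I I' ->
  0 <= Q -> lip Q phi -> bounded_by P phi ->
  `|stransform I kap phi x - stransform I' kap phi x| <=
    expR (2 * (P + M)) * (Q + L) * w.
Proof.
move=> SI SI' Gk II Q0 pQ pP; have cp := lip_continuous pQ.
have L0 : 0 <= L by case: Gk.
rewrite /stransform -opprD normrN.
have /andP[a1 _] := state_integrand SI Gk x cp pP.
have /andP[a2 _] := state_integrand SI' Gk x cp pP.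
apply: le_trans (ln_diff_le (expR_gt0 _) a1 a2) _.
rewrite -expRN opprK (_ : 2 * (P + M) = (P + M) + (P + M)); last by ring.
rewrite [in leRHS]expRD -!mulrA.
rewrite ler_wpM2l ?expR_ge0// mulrA.
have [_ _ k1 _] := Gk.
apply: (II _ (expR (P + M))).
- by rewrite mulr_ge0 ?expR_ge0// addr_ge0.
- apply: lip_expR; first exact: lipB.
  by move=> y; rewrite -ler_expR; case/andP: (integrand_bounds Gk x y pP).
- move=> y; rewrite ger0_norm ?expR_ge0//.
  by case/andP: (integrand_bounds Gk x y pP).
Qed.

End Transform.

(** * Existence and stability of solutions *)

Section RealSequences.
Context {R : realType}.

(** The sequence [a n - r n] increases and [a n + r n] decreases. *)
Lemma squeeze_limit (a r : nat -> R) : (forall n, 0 <= r n) ->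
  (forall n, `|a n.+1 - a n| <= r n - r n.+1) ->
  exists l, forall n, `|l - a n| <= r n.
Proof.
move=> r0 ar.
have up n j : a (n + j)%N + r (n + j)%N <= a n + r n.
  elim: j => [|j IH]; first by rewrite addn0.
  rewrite addnS; apply: le_trans IH.
  by have := ar (n + j)%N; rewrite ler_norml => /andP[_]; lra.
have lo n j : a n - r n <= a (n + j)%N - r (n + j)%N.
  elim: j => [|j IH]; first by rewrite addn0.
  rewrite addnS; apply: le_trans IH _.
  by have := ar (n + j)%N; rewrite ler_norml => /andP[+ _]; lra.
have cmp n j : a n - r n <= a j + r j.
  have := lo n j; have := up j n; rewrite addnC.
  by have := r0 (n + j)%N; lra.
pose S := range (fun n => a n - r n).
have S0 : S !=set0 by exists (a 0%N - r 0%N), 0%N.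
exists (sup S) => n; rewrite ler_distl; apply/andP; split.
  by apply: ub_le_sup; [exists (a 0%N + r 0%N) => _ [j _ <-] | exists n].
by apply: ge_sup => // _ [j _ <-].
Qed.

Lemma geometric_small (q D e : R) : 0 <= q < 1 -> 0 < e ->
  exists n, q ^+ n * D <= e.
Proof.
move=> /andP[q0 q1] e0.
have cq : (fun n => q ^+ n * D) @ \oo --> (0 * D : R).
  apply: cvgM; last exact: cvg_cst.
  by apply: cvg_expr; rewrite ger0_norm.
move: cq; rewrite mul0r => /cvgrPdist_le/(_ _ e0)[n _ Hn].
exists n; have := Hn n (leqnn n); rewrite /= sub0r normrN.
exact/le_trans/ler_norm.
Qed.

Lemma le_of_geometric (q D a b : R) : 0 <= q < 1 ->
  (forall n, a <= b + q ^+ n * D) -> a <= b.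
Proof.
move=> q01 H; apply/ler_addgt0Pr => e e0.
have [n Hn] := geometric_small D q01 e0.
by apply: le_trans (H n) _; rewrite lerD2l.
Qed.

End RealSequences.

Section SchrodingerSystem.
Context {R : realType} {V : normedModType R}.
Implicit Types (X : set V) (phi psi : V -> R) (I : (V -> R) -> R)
  (kap : V -> V -> R).

Definition solves I1 I2 kap phi1 phi2 :=
  (forall x, phi1 x = stransform I2 kap phi2 x) /\
  (forall y, phi2 y = stransform I1 (fun y x => kap x y) phi1 y).

Lemma rate_bounds (M : R) : 0 <= M ->
  0 <= 1 - expR (- (4 * M)) < 1.
Proof.
move=> M0; have : expR (- (4 * M)) <= expR 0 by rewrite ler_expR; lra.
by have := expR_gt0 (- (4 * M)); rewrite expR0 => ? ?; apply/andP; split; lra.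
Qed.

Section Existence.
Context {X1 X2 : set V} {I1 I2 : (V -> R) -> R} {M L : R} {kap : V -> V -> R}.
Hypotheses (cX1 : compact X1) (SI1 : state X1 I1) (SI2 : state X2 I2)
  (Gk : good_cost M L kap).

Let Gk' := good_costT Gk.
Let T12 := stransform I2 kap.
Let T21 := stransform I1 (fun y x => kap x y).
Let A phi := T12 (T21 phi).
Let step phi x := A phi x - A phi 0.
Let a n := iter n step (fun=> 0).
Let aS n x : a n.+1 x = A (a n) x - A (a n) 0. Proof. by []. Qed.
Let q := 1 - expR (- (4 * M)).

Let M0 : 0 <= M.
Proof. by have [_ /(_ 0 0) + _ _] := Gk; exact: le_trans. Qed.

Let q01 : 0 <= q < 1. Proof. exact: rate_bounds. Qed.

Let good B phi := lip L phi /\ bounded_by B phi.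

Let good_T21 B phi : good B phi -> good (B + M) (T21 phi).
Proof.
move=> [lp bp]; have cp := lip_continuous lp.
by split; [exact: (stransform_lip SI1 Gk' cp bp)|exact: (stransform_bounded SI1 Gk' cp bp)].
Qed.

Let good_A B phi : good B phi -> good (B + M + M) (A phi).
Proof.
move=> /good_T21[lp bp]; have cp := lip_continuous lp.
by split; [exact: (stransform_lip SI2 Gk cp bp)|exact: (stransform_bounded SI2 Gk cp bp)].
Qed.

Let good_a n : good (2 * M) (a n).
Proof.
elim: n => [|n IH].
  split=> [x y|x]; rewrite /a/= ?subrr normr0 ?mulr_ge0//.
  by case: Gk.
have [lA bA] := good_A IH; have [lT bT] := good_T21 IH; split.
  by move=> x y; rewrite /a/= /step opprB addrA subrK; exact: lA.
have cT := lip_continuous lT.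
move=> x; rewrite /a/= /step ler_norml; apply/andP; split.
  by have := stransform_osc SI2 Gk x 0 cT bT; rewrite /A /T12; lra.
exact: (stransform_osc SI2 Gk 0 x cT bT).
Qed.

Let A_contraction B phi psi D : good B phi -> good B psi ->
  (forall y y', (phi y - psi y) - (phi y' - psi y') <= D) ->
  forall x x', (A phi x - A psi x) - (A phi x' - A psi x') <= q ^+ 2 * D.
Proof.
move=> Gp Gq H x x'; have [lp bp] := Gp; have [lq bq] := Gq.
have [lTp bTp] := good_T21 Gp; have [lTq bTq] := good_T21 Gq.
rewrite expr2 -mulrA; apply: (stransform_contraction SI2 Gk _ _ bTp bTq).
- exact: lip_continuous lTp.
- exact: lip_continuous lTq.
apply: (stransform_contraction SI1 Gk' _ _ bp bq H).
- exact: lip_continuous lp.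
- exact: lip_continuous lq.
Qed.

Let a_osc n x x' : (a n.+1 x - a n x) - (a n.+1 x' - a n x') <=
  (q ^+ 2) ^+ n * (4 * M).
Proof.
elim: n x x' => [|n IH] x x'.
  rewrite expr0 mul1r; have [_ b1] := good_a 1%N.
  have := b1 x; have := b1 x'; rewrite !ler_norml => /andP[? ?] /andP[? ?].
  have a0E z : a 0%N z = 0 by [].
  by rewrite !a0E; lra.
have cancel (u v c d u' v' : R) :
    (u - c) - (v - d) - ((u' - c) - (v' - d)) = (u - v) - (u' - v') by ring.
rewrite !aS cancel (exprS (q ^+ 2)) -mulrA.
exact: (A_contraction (good_a n.+1) (good_a n) IH).
Qed.

Let a0 n : a n 0 = 0.
Proof. by case: n => //= n; rewrite /a/= /step subrr. Qed.

Let r n := (q ^+ 2) ^+ n * (4 * M / (1 - q ^+ 2)).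

Let q2 : 0 <= q ^+ 2 < 1.
Proof.
case/andP: q01 => q0 q1; rewrite exprn_ge0//=.
by rewrite exprn_ilt1.
Qed.

Let r0 n : 0 <= r n.
Proof.
case/andP: q2 => h0 h1; apply: mulr_ge0; first exact: exprn_ge0.
by apply: divr_ge0; [exact: mulr_ge0 | rewrite subr_ge0 ltW].
Qed.

Let limit_exists : exists l, forall x n, `|l x - a n x| <= r n.
Proof.
suff /choice[l Hl] : forall x, exists l, forall n, `|l - a n x| <= r n by exists l.
move=> x.
apply: (squeeze_limit (a := a^~ x)) => // n.
have -> : r n - r n.+1 = (q ^+ 2) ^+ n * (4 * M).
  have E (Q : R) : Q < 1 -> Q ^+ n * (4 * M / (1 - Q)) - Q ^+ n.+1 * (4 * M / (1 - Q)) =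
      Q ^+ n * (4 * M).
    move=> Q1; rewrite exprS; move: (Q ^+ n) => v.
    by field; rewrite subr_eq0 gt_eqF.
  by apply: E; case/andP: q2.
rewrite ler_norml; have := a_osc n x 0; have := a_osc n 0 x.
by rewrite !a0 => ? ?; apply/andP; split; lra.
Qed.

(** The iteration, normalised at the origin, converges geometrically to a
    fixed point [l] up to an additive constant; Fubini's theorem forces this
    constant to vanish. *)
Lemma solution_exists : exists phi1 phi2,
  [/\ solves I1 I2 kap phi1 phi2, lip L phi1, lip L phi2,
      bounded_by (2 * M) phi1 & bounded_by (3 * M) phi2].
Proof.
have [l Hl] := limit_exists.
have lr x n : a n x - r n <= l x <= a n x + r n.
  by rewrite -ler_distl.
have small (u v : R) c : (forall n, u <= v + c * r n) -> u <= v.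
  move=> H; apply: (le_of_geometric q2 (D := c * (4 * M / (1 - q ^+ 2)))) => n.
  by apply: le_trans (H n) _; rewrite lerD2l /r mulrCA.
have ll : lip L l.
  move=> x y; apply: (small _ _ 2) => n.
  have [la _] := good_a n; have := la x y.
  have /andP[? ?] := lr x n; have /andP[? ?] := lr y n.
  by rewrite !ler_norml => /andP[? ?]; apply/andP; split; lra.
have bl : bounded_by (2 * M) l.
  move=> x; apply: (small _ _ 1) => n.
  have [_ ba] := good_a n; have := ba x; have /andP[? ?] := lr x n.
  by rewrite !ler_norml => /andP[? ?]; apply/andP; split; lra.
have gl : good (2 * M) l by [].
have [lT bT] := good_T21 gl.
have cl := lip_continuous ll; have cT := lip_continuous lT.
have near_A n x : `|A l x - A (a n) x| <= r n.
  have [la ba] := good_a n; have [lTa bTa] := good_T21 (good_a n).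
  apply: (stransform_sup SI2 Gk cT (lip_continuous lTa) bT bTa).
  by apply: (stransform_sup SI1 Gk' cl (lip_continuous la) bl ba) => y.
have fixl x : A l x - A l 0 = l x.
  have E n : `|A l x - A l 0 - l x| <= 3 * r n.
    have rr : r n.+1 <= r n.
      rewrite /r (exprS (q ^+ 2)) -mulrA ler_piMl//; first exact: r0.
      by case/andP: q2 => _ /ltW.
    have tri (p p0 u u0 z s s' : R) : `|p - u| <= s -> `|p0 - u0| <= s ->
        u - u0 - s' <= z <= u - u0 + s' -> s' <= s -> `|p - p0 - z| <= 3 * s.
      rewrite !ler_norml => /andP[? ?] /andP[? ?] /andP[? ?] ?.
      by apply/andP; split; lra.
    apply: tri (near_A n x) (near_A n 0) _ rr.
    by rewrite -aS; exact: lr.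
  apply/eqP; rewrite -subr_eq0 -normr_le0; apply: (small _ _ 3) => n.
  by rewrite add0r.
pose c := A l 0.
pose h x y := expR (l x + T21 l y - kap x y).
have [L0 kM k1 k2] := Gk.
have hC x y : l x + T21 l y - kap x y <= 2 * M + (2 * M + M) + M.
  have := bl x; have := bT y; have := kM x y.
  by rewrite !ler_norml => /andP[? ?] /andP[? ?] /andP[? ?]; lra.
have hl y : lip (expR (2 * M + (2 * M + M) + M) * (L + L)) (h^~ y).
  apply: lip_expR => [x x'|x]; last exact: hC.
  have -> : l x + T21 l y - kap x y - (l x' + T21 l y - kap x' y) =
     l x - kap x y - (l x' - kap x' y) by ring.
  exact: (lipB ll (k2 y)).
have hr x : lip (expR (2 * M + (2 * M + M) + M) * (L + L)) (h x).
  apply: lip_expR => [y y'|y]; last exact: hC.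
  have -> : l x + T21 l y - kap x y - (l x + T21 l y' - kap x y') =
     T21 l y - kap x y - (T21 l y' - kap x y') by ring.
  exact: (lipB lT (k1 x)).
have := state_Fubini cX1 SI1 SI2 (mulr_ge0 (expR_ge0 _) (addr_ge0 L0 L0)) hl hr.
have -> : (fun x => I2 (h x)) = (fun=> expR (- c)).
  apply/funext => x.
  have -> : h x = (fun y => expR (l x) * expR (T21 l y - kap x y)).
    by apply/funext => y; rewrite -expRD addrA.
  rewrite (stateZ SI2); last exact: (continuous_integrand Gk cT).
  rewrite -(expR_stransform SI2 Gk x cT bT) -expRD; congr expR.
  by rewrite -/T12 -/(A l) -(fixl x) /c; lra.
have -> : (fun y => I1 (h^~ y)) = (fun=> 1).
  apply/funext => y.
  have -> : h^~ y = (fun x => expR (T21 l y) * expR (l x - kap x y)).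
    by apply/funext => x; rewrite -expRD /h; congr expR; ring.
  rewrite (stateZ SI1); last exact: (continuous_integrand Gk' cl).
  by rewrite -(expR_stransform SI1 Gk' y cl bl) -expRD -/T21 subrr expR0.
rewrite (state_cst SI1) (state_cst SI2) => E.
have c0 : c = 0 by apply: oppr_inj; apply: expR_inj; rewrite oppr0 expR0.
have b3 : bounded_by (3 * M) (T21 l) by move=> y; apply: le_trans (bT y) _; lra.
exists l, (T21 l); split => //; split => // x.
by rewrite -[LHS]fixl -/c c0 subr0.
Qed.

End Existence.

Section Stability.
Context {X1 X2 X1' X2' : set V} {I1 I2 I1' I2' : (V -> R) -> R}
  {M L : R} {kap : V -> V -> R}.
Hypotheses (SI1 : state X1 I1) (SI2 : state X2 I2)
  (SI1' : state X1' I1') (SI2' : state X2' I2') (Gk : good_cost M L kap).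

Let Gk' := good_costT Gk.

(** Transforms oscillate by at most [2 * M], whatever their argument. *)
Lemma solution_bounds X Y I J P phi1 phi2 : state X I -> state Y J ->
  solves I J kap phi1 phi2 -> phi1 0 = 0 ->
  continuous phi1 -> continuous phi2 -> bounded_by P phi1 -> bounded_by P phi2 ->
  [/\ lip L phi1, lip L phi2, bounded_by (2 * M) phi1 & bounded_by (3 * M) phi2].
Proof.
move=> SI SJ [E1 E2] p0 c1 c2 b1 b2.
have E1' : phi1 = stransform J kap phi2 by exact/funext.
have E2' : phi2 = stransform I (fun y x => kap x y) phi1 by exact/funext.
have B1 : bounded_by (2 * M) phi1.
  move=> x; have := stransform_osc SJ Gk x 0 c2 b2.
  have := stransform_osc SJ Gk 0 x c2 b2.
  rewrite -!E1 p0 => ? ?; rewrite ler_norml; apply/andP; split; lra.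
split => //.
- by rewrite E1'; exact: (stransform_lip SJ Gk c2 b2).
- by rewrite E2'; exact: (stransform_lip SI Gk' c1 b1).
- move=> y; rewrite E2; apply: le_trans (stransform_bounded SI Gk' c1 B1 y) _; lra.
Qed.

(** Comparing both systems, the oscillations [D1], [D2] of the differences of
    the potentials satisfy [D1 <= q * D2 + b] and [D2 <= q * D1 + b], with
    [q < 1] and [b] proportional to the distance [w] of the measures. *)
Lemma solution_stable w P phi1 phi2 phi1' phi2' :
  dual_close w I1 I1' -> dual_close w I2 I2' ->
  solves I1 I2 kap phi1 phi2 -> solves I1' I2' kap phi1' phi2' ->
  phi1 0 = 0 -> phi1' 0 = 0 ->
  continuous phi1 -> continuous phi2 -> continuous phi1' -> continuous phi2' ->
  bounded_by P phi1 -> bounded_by P phi2 ->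
  bounded_by P phi1' -> bounded_by P phi2' ->
  let C := expR (2 * (3 * M + M)) * (L + L) * (4 / expR (- (4 * M)) + 1) in
  (forall x, `|phi1 x - phi1' x| <= C * w) /\
  (forall y, `|phi2 y - phi2' y| <= C * w).
Proof.
move=> w1 w2 S S' z z' c1 c2 c1' c2' b1 b2 b1' b2'.
have [l1 l2 B1 B2] := solution_bounds SI1 SI2 S z c1 c2 b1 b2.
have [l1' l2' B1' B2'] := solution_bounds SI1' SI2' S' z' c1' c2' b1' b2'.
case: S S' => [E1 E2] [E1' E2'].
have [L0 /(_ 0 0) k00 _ _] := Gk.
have M0 : 0 <= M := le_trans (normr_ge0 _) k00.
pose s := expR (2 * (3 * M + M)) * (L + L) * w.
have B13 : bounded_by (3 * M) phi1 by move=> x; apply: le_trans (B1 x) _; lra.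
have B13' : bounded_by (3 * M) phi1' by move=> x; apply: le_trans (B1' x) _; lra.
have s1 x : `|stransform I2 kap phi2' x - stransform I2' kap phi2' x| <= s.
  exact: (stransform_stable x SI2 SI2' Gk w2 L0 l2' B2').
have s2 y : `|stransform I1 (fun y x => kap x y) phi1' y -
    stransform I1' (fun y x => kap x y) phi1' y| <= s.
  exact: (stransform_stable y SI1 SI1' Gk' w1 L0 l1' B13').
pose e := expR (- (4 * M)); have e0 : 0 < e := expR_gt0 _.
have /andP[q0 q1] := rate_bounds M0.
have step1 D : (forall y y', (phi2 y - phi2' y) - (phi2 y' - phi2' y') <= D) ->
    forall x x', (phi1 x - phi1' x) - (phi1 x' - phi1' x') <= (1 - e) * D + 2 * s.
  move=> H x x'; rewrite !E1 !E1'.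
  have := stransform_contraction SI2 Gk c2 c2' B2 B2' H x x'; rewrite -/e.
  have := s1 x; have := s1 x'; rewrite !ler_norml => /andP[? ?] /andP[? ?].
  by lra.
have step2 D : (forall y y', (phi1 y - phi1' y) - (phi1 y' - phi1' y') <= D) ->
    forall x x', (phi2 x - phi2' x) - (phi2 x' - phi2' x') <= (1 - e) * D + 2 * s.
  move=> H x x'; rewrite !E2 !E2'.
  have := stransform_contraction SI1 Gk' c1 c1' B13 B13' H x x'; rewrite -/e.
  have := s2 x; have := s2 x'; rewrite !ler_norml => /andP[? ?] /andP[? ?].
  by lra.
pose U := [set (phi1 p.1 - phi1' p.1) - (phi1 p.2 - phi1' p.2) | p in [set: V * V]].
have hU : has_sup U.
  split; first by exists ((phi1 0 - phi1' 0) - (phi1 0 - phi1' 0)), (0, 0).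
  exists (8 * M) => _ [[x x'] _ <-] /=.
  have := B1 x; have := B1 x'; have := B1' x; have := B1' x'.
  by rewrite !ler_norml => /andP[? ?] /andP[? ?] /andP[? ?] /andP[? ?]; lra.
have DU x x' : (phi1 x - phi1' x) - (phi1 x' - phi1' x') <= sup U.
  by apply: ub_le_sup; [exact: hU.2 | exists (x, x')].
have D0 : 0 <= sup U by have := DU 0 0; rewrite subrr.
have s0 : 0 <= s := le_trans (normr_ge0 _) (s1 0).
have De : e * sup U <= 4 * s.
  have : sup U <= (1 - e) * ((1 - e) * sup U + 2 * s) + 2 * s.
    apply: ge_sup; first exact: hU.1.
    by move=> _ [[x x'] _ <-] /=; apply: step1; exact: step2.
  have : (1 - e) * ((1 - e) * sup U + 2 * s) <= (1 - e) * sup U + 2 * s.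
    have qe : 0 <= 1 - e := q0.
    apply: ler_piMl; last by rewrite lerBlDr lerDl ltW.
    by apply: addr_ge0; apply: mulr_ge0.
  lra.
have H1 x : `|phi1 x - phi1' x| <= 4 / e * s.
  apply: (@le_trans _ _ (sup U)).
    have := DU x 0; have := DU 0 x; rewrite z z' ler_norml => ? ?.
    by apply/andP; split; lra.
  by rewrite mulrAC ler_pdivlMr// mulrC.
have H2 y : `|phi2 y - phi2' y| <= 4 / e * s + s.
  rewrite E2 E2'; apply: le_trans (ler_distD (stransform I1 (fun y x => kap x y) phi1' y) _ _) _.
  apply: lerD; last exact: s2.
  exact: (stransform_sup SI1 Gk' c1 c1' B13 B13' H1).
have CE : expR (2 * (3 * M + M)) * (L + L) * (4 / expR (- (4 * M)) + 1) * w =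
    4 / e * s + s by rewrite /s /e; ring.
rewrite /= CE; split => // x.
by apply: le_trans (H1 x) _; rewrite lerDl.
Qed.

End Stability.

End SchrodingerSystem.

(** * Borel probabilities and the Wasserstein distance *)

Section BorelProbabilities.
Context {R : realType} {d : nat}.
Local Notation Rd := (Rd R d).
Implicit Types (f : 'rV[R]_d -> R) (X : set 'rV[R]_d) (mu nu : probability Rd R).

Lemma measurable_closed X : closed X -> measurable (X : set Rd).
Proof.
move=> cX; rewrite -[X]setCK; apply: measurableC.
by apply: sub_sigma_algebra; exact: closed_openC.
Qed.

Lemma measurable_compact X : compact X -> measurable (X : set Rd).
Proof.
move=> cX; apply: measurable_closed; apply: compact_closed cX.
exact: (@norm_hausdorff _ 'rV[R]_d).
Qed.

Lemma measurable_continuous f : continuous f ->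
  measurable_fun setT (f : Rd -> R).
Proof.
move=> cf; apply: (measurability _ (RGenOpens.measurableE R)).
move=> _ [_ [a [b ->] <-]]; rewrite setTI; apply: sub_sigma_algebra.
by apply: open_comp => //; exact: interval_open.
Qed.

Definition integral_on X mu f := \int[mu]_(y in (X : set Rd)) f y.

Lemma integrable_continuous X mu f : compact X -> continuous f ->
  mu.-integrable (X : set Rd) (EFin \o f).
Proof.
move=> cX cf; apply: measurable_bounded_integrable.
- exact: measurable_compact.
- by rewrite (le_lt_trans (probability_le1 _ _)) ?ltry//; exact: measurable_compact.
- by apply: measurable_funTS; exact: measurable_continuous.
have [B _ fB] := continuous_compact_bounded cX cf.
exists B; split; first exact: num_real.
by move=> M BM x Xx; exact: le_trans (fB x Xx) (ltW BM).
Qed.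

Lemma state_integral X mu : compact X -> prob_on X mu ->
  state X (integral_on X mu).
Proof.
move=> cX muX; have mX := measurable_compact cX.
split=> [|a f g cf cg|f cf f0].
- rewrite /integral_on Rintegral_cst// mul1r -[RHS]/(fine 1%E).
  by congr fine; exact: muX.
- rewrite /integral_on RintegralD//.
  + by rewrite RintegralZl//; exact: integrable_continuous.
  + apply: integrable_continuous => //; exact: continuous_scale.
  + exact: integrable_continuous.
- exact: Rintegral_ge0.
Qed.

Lemma integral_onT X mu f B : compact X -> prob_on X mu -> continuous f ->
  bounded_by B f -> (integral_on X mu f)%:E = (\int[mu]_(y in setT) (f y)%:E)%E.
Proof.
move=> cX muX cf fB; have mX := measurable_compact cX.
rewrite /integral_on /Rintegral fineK; last first.
  by apply: integrable_fin_num => //; exact: integrable_continuous.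
have intT : mu.-integrable setT (EFin \o (f : Rd -> R)).
  apply: measurable_bounded_integrable => //.
  - by rewrite (le_lt_trans (probability_le1 _ _)) ?ltry.
  - exact: measurable_continuous.
  - exists B; split; first exact: num_real.
    by move=> M BM x _; exact: le_trans (fB x) (ltW BM).
have mu0 : mu (~` (X : set Rd)) = 0%E.
  have muX1 : mu (X : set Rd) = 1%E := muX.
  by rewrite probability_setC// muX1 subee.
rewrite [RHS](negligible_integral (measurableC mX))//.
  by rewrite setDE setCK setTI.
Qed.

Lemma enorm_sqr (x : 'rV[R]_d) : enorm x ^+ 2 = sqnorm x.
Proof. by rewrite sqr_sqrtr// sumr_ge0// => i _; exact: sqr_ge0. Qed.

Lemma measurable_cost : measurable_fun setT
  (fun z : (Rd * Rd)%type => enorm ((z.2 : 'rV[R]_d) - (z.1 : 'rV[R]_d)) ^+ 2).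
Proof.
rewrite [X in measurable_fun _ X](_ : _ =
    (fun z : (Rd * Rd)%type => \sum_i ((z.2 : 'rV[R]_d) 0 i - (z.1 : 'rV[R]_d) 0 i) ^+ 2)).
  have mcoord i : measurable_fun setT (fun x : Rd => (x : 'rV[R]_d) 0 i).
    by apply: measurable_continuous => x; exact: coord_continuous.
  apply: measurable_sum => i; apply: measurable_funX; apply: measurable_funB.
    exact: (measurableT_comp (mcoord i) measurable_snd).
  exact: (measurableT_comp (mcoord i) measurable_fst).
apply/funext => z; rewrite enorm_sqr; apply: eq_bigr => i _.
by rewrite !mxE.
Qed.

(** The inequality of Cauchy and Schwarz for the coupling, obtained by integrating
    the bound 2 t |x - y| <= t^2 + |x - y|^2, in which every [t > 0] is allowed:
    this needs no integrability of the cost. *)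
Lemma sqr_le_transport_cost X mu nu f (Q B : R) : compact X ->
  prob_on X mu -> prob_on X nu -> 0 < Q -> lip Q f -> bounded_by B f ->
  forall gamma, couplings mu nu gamma ->
  (((`|integral_on X mu f - integral_on X nu f| / Q) ^+ 2)%:E <=
  \int[gamma]_z ((enorm ((z.2 : 'rV[R]_d) - (z.1 : 'rV[R]_d)) ^+ 2)%R)%:E)%E.
Proof.
move=> cX muX nuX Q0 fQ fB gamma cpl; have cf := lip_continuous fQ.
have mf := measurable_continuous cf.
pose cost (z : (Rd * Rd)%type) : R := enorm ((z.2 : 'rV[R]_d) - (z.1 : 'rV[R]_d)) ^+ 2.
have intp (p : (Rd * Rd)%type -> Rd) : measurable_fun setT p ->
    gamma.-integrable setT (EFin \o (fun z => f (p z))).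
  move=> mp; apply: measurable_bounded_integrable => //.
  - by rewrite (le_lt_trans (probability_le1 _ _)) ?ltry.
  - exact: (measurableT_comp mf mp).
  - exists B; split; first exact: num_real.
    by move=> M BM x _; exact: le_trans (fB _) (ltW BM).
have marg (p : (Rd * Rd)%type -> Rd) (rho : probability Rd R)
    (mp : measurable_fun setT p) :
    (forall A : set Rd, measurable A -> pushforward gamma p A = rho A) ->
    prob_on X rho ->
    (integral_on X rho f)%:E = (\int[gamma]_z (f (p z))%:E)%E.
  move=> H rhoX; rewrite (integral_onT cX rhoX cf fB).
  have -> : (\int[rho]_(y in setT) (f y)%:E = \int[pushforward gamma p]_(y in setT) (f y)%:E)%E.
    by apply: eq_measure_integral => A mA _; exact/esym/H.
  rewrite (integral_pushforward mp)//.
    exact/measurable_EFinP.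
  by rewrite preimage_setT; exact: intp.
have Emu := marg _ _ measurable_fst (fun A mA => (cpl A mA).1) muX.
have Enu := marg _ _ measurable_snd (fun A mA => (cpl A mA).2) nuX.
set D : R := `|_ - _|.
have cost0 z : 0 <= cost z by exact: sqr_ge0.
have mcost : measurable_fun setT (EFin \o cost) by apply/measurable_EFinP; exact: measurable_cost.
have key (t : R) : 0 < t -> (D%:E <= (Q / 2 * t)%:E + (Q / (2 * t))%:E *
    \int[gamma]_z (cost z)%:E)%E.
  move=> t0; have Qt : 0 <= Q / (2 * t) by rewrite divr_ge0 ?mulr_ge0 ?ltW.
  have -> : D%:E = `| \int[gamma]_z (f z.1 - f z.2)%:E |%E.
    rewrite /D -abse_EFin EFinB Emu Enu -integralB_EFin//; exact: intp.
  apply: le_trans (le_abse_integral _ _ _) _ => //.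
    apply/measurable_EFinP; apply: measurable_funB.
      exact: (measurableT_comp mf measurable_fst).
    exact: (measurableT_comp mf measurable_snd).
  have -> : ((Q / 2 * t)%:E + (Q / (2 * t))%:E * \int[gamma]_z (cost z)%:E =
     \int[gamma]_z ((Q / 2 * t)%:E + (Q / (2 * t))%:E * (cost z)%:E))%E.
    rewrite ge0_integralD//; last 3 first.
    - by move=> z _; rewrite lee_fin mulr_ge0 ?divr_ge0 ?ltW.
    - by move=> z _; rewrite -EFinM lee_fin mulr_ge0.
    - exact: measurable_funeM.
    have -> : (\int[gamma]_z ((Q / (2 * t))%:E * (cost z)%:E) =
        (Q / (2 * t))%:E * \int[gamma]_z (cost z)%:E)%E.
      by apply: ge0_integralZl => // z _; rewrite lee_fin.
    congr (_ + _)%E.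
    rewrite integral_cst// -[LHS]mule1; congr (_ * _)%E.
    exact/esym/(probability_setT gamma).
  apply: ge0_le_integral => //.
  - apply: measurableT_comp => //; apply/measurable_EFinP; apply: measurable_funB.
      exact: (measurableT_comp mf measurable_fst).
    exact: (measurableT_comp mf measurable_snd).
  - apply: emeasurable_funD => //; exact: measurable_funeM.
  move=> z _; rewrite -EFinM -EFinD abse_EFin lee_fin.
  apply: le_trans (fQ _ _) _.
  set n := `|_|; have n2 : n ^+ 2 <= cost z.
    rewrite /cost enorm_sqr; apply: le_trans (sqr_norm_le_sqnorm _).
    by rewrite distrC.
  have -> : Q / 2 * t + Q / (2 * t) * cost z = Q * ((t ^+ 2 + cost z) / (2 * t)).
    by field; rewrite gt_eqF.
  rewrite ler_wpM2l ?(ltW Q0)// ler_pdivlMr ?mulr_gt0//.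
  apply: (@le_trans _ _ (t ^+ 2 + n ^+ 2)); last by rewrite lerD2l.
  by have := sqr_ge0 (t - n); nra.
have I0 : (0 <= \int[gamma]_z (cost z)%:E)%E.
  by apply: integral_ge0 => z _; rewrite lee_fin.
rewrite -/cost; move: I0 key; case: (integral _ _ _) => [c| |] //=; last by move=> *; rewrite leey.
rewrite lee_fin => c0 key; rewrite lee_fin expr_div_n ler_pdivrMr ?exprn_gt0//.
have D0 : 0 <= D by exact: normr_ge0.
have {}key t : 0 < t -> D * (2 * t) <= Q * (t ^+ 2 + c).
  move=> t0; have := key t t0; rewrite -EFinM -EFinD lee_fin => H.
  have -> : Q * (t ^+ 2 + c) = (Q / 2 * t + Q / (2 * t) * c) * (2 * t).
    by field; rewrite gt_eqF.
  by rewrite ler_wpM2r// mulr_ge0// ltW.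
have [->|Dn0] := eqVneq D 0; first by rewrite expr0n mulr_ge0// sqr_ge0.
(* The choice of t that minimises the quadratic Q t^2 - 2 D t + Q c. *)
have Dgt : 0 < D by rewrite lt_def Dn0.
have := key (D / Q) (divr_gt0 Dgt Q0).
have -> : D * (2 * (D / Q)) = 2 * (D ^+ 2 / Q) by ring.
have -> : Q * ((D / Q) ^+ 2 + c) = D ^+ 2 / Q + Q * c by field; rewrite gt_eqF.
move=> H; have {}H : D ^+ 2 / Q <= Q * c by lra.
by move: H; rewrite ler_pdivrMr// => H; apply: le_trans H _; rewrite expr2 mulrAC mulrC mulrA.
Qed.

Lemma dual_close_W2 X mu nu (w : R) : compact X -> prob_on X mu -> prob_on X nu ->
  (W2 mu nu <= w%:E)%E -> dual_close w (integral_on X mu) (integral_on X nu).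
Proof.
move=> cX muX nuX Ww.
have pos Q B f : 0 < Q -> lip Q f -> bounded_by B f ->
    `|integral_on X mu f - integral_on X nu f| <= Q * w.
  move=> Q0 fQ fB; set D := `|_|.
  have DQ : 0 <= D / Q by apply: divr_ge0; [exact: normr_ge0 | exact: ltW].
  rewrite mulrC -ler_pdivrMr// -lee_fin; apply: le_trans Ww.
  have -> : (D / Q)%:E = (((D / Q) ^+ 2)%:E `^ 2^-1)%E.
    by rewrite poweR_EFin powR12_sqrt ?sqr_ge0// sqrtr_sqr ger0_norm.
  have le_inf : (((D / Q) ^+ 2)%:E <= ereal_inf
     [set \int[gamma]_z ((enorm ((z.2 : 'rV[R]_d) - (z.1 : 'rV[R]_d)) ^+ 2)%R)%:E |
      gamma in couplings mu nu])%E.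
    apply: le_ereal_inf_tmp => _ [gamma cpl <-].
    exact: (sqr_le_transport_cost cX muX nuX Q0 fQ fB).
  have S0 : (0 <= ((D / Q) ^+ 2)%:E)%E by rewrite lee_fin sqr_ge0.
  apply: (gt0_ler_poweR _ _ _ le_inf); first by rewrite invr_ge0.
    by rewrite in_itv/= S0 leey.
  by rewrite in_itv/= leey andbT; exact: le_trans le_inf.
move=> Q B f Q0 fQ fB.
have [Qp|Qn] := ltP 0 Q; first exact: pos fB.
have Qz : Q = 0 by apply/eqP; rewrite eq_le Qn.
rewrite Qz mul0r; apply/ler_addgt0Pl => e e0; rewrite addr0.
(* For Q = 0 there is nothing to divide by; a small positive constant is used
   instead, chosen so that its product with [w] is at most [e]. *)
have w1 : 0 < `|w| + 1 by rewrite ltr_wpDl.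
have : `|integral_on X mu f - integral_on X nu f| <= e / (`|w| + 1) * w.
  apply: (pos _ B) => //; first by rewrite divr_gt0.
  by apply: lip_le fQ; rewrite Qz divr_ge0 ?ltW.
move=> H; apply: le_trans H _; rewrite mulrAC ler_pdivrMr// ler_wpM2l ?(ltW e0)//.
by rewrite (le_trans (ler_norm w))// lerDl.
Qed.

Lemma W2_le_pair (mu1 mu2 nu1 nu2 : probability Rd R) (w : R) :
  (W2_pair mu1 mu2 nu1 nu2 <= w%:E)%E ->
  (W2 mu1 nu1 <= w%:E)%E /\ (W2 mu2 nu2 <= w%:E)%E.
Proof.
move=> H; have a0 : (0 <= W2 mu1 nu1)%E by exact: poweR_ge0.
have b0 : (0 <= W2 mu2 nu2)%E by exact: poweR_ge0.
have H' (a b : \bar R) : (0 <= a)%E -> (0 <= b)%E ->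
    ((a ^+ 2 + b ^+ 2) `^ 2^-1 <= w%:E)%E -> (a <= w%:E)%E.
  move=> ha hb; rewrite poweR12_sqrt ?adde_ge0 ?expe_ge0//; apply: le_trans.
  rewrite -[leLHS]gee0_abs// -sqrte_sqr lee_sqrt ?adde_ge0 ?expe_ge0//.
  by rewrite leeDl// expe_ge0.
by split; [exact: H' H | apply: H' b0 a0 _; rewrite addeC].
Qed.

End BorelProbabilities.

(** * Regularity of the potentials *)

Section PotentialRegularity.
Context {R : realType} {d : nat}.
Implicit Types (g : 'rV[R]_(d + d) -> R) (X : set 'rV[R]_d) (phi f : 'rV[R]_d -> R)
  (I : ('rV[R]_d -> R) -> R).

Definition cost_of g (x y : 'rV[R]_d) := g (row_mx x y).

Lemma good_cost_of k M g : bC k.+1 M g -> good_cost M (d%:R * M) (cost_of g).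
Proof.
move=> gM; have M0 := bC_ge0 gM; split.
- by rewrite mulr_ge0.
- by move=> x y; exact: bC_bound gM.
- by move=> x; exact: bC_lip (bC_freeze_l x gM).
- by move=> y; exact: bC_lip (bC_freeze_r y gM).
Qed.

Lemma lipM (A L B Q : R) (f g : 'rV[R]_d -> R) : 0 <= A -> 0 <= Q ->
  bounded_by A f -> lip L f -> bounded_by B g -> lip Q g ->
  lip (A * Q + L * B) (fun x => f x * g x).
Proof.
move=> A0 Q0 fA fL gB gQ x y.
have -> : f x * g x - f y * g y = f x * (g x - g y) + (f x - f y) * g y by ring.
apply: le_trans (ler_normD _ _) _; rewrite !normrM mulrDl; apply: lerD.
  by rewrite -mulrA ler_pM//; exact: gQ.
by rewrite mulrAC ler_pM//; exact: fL.
Qed.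

Lemma continuous_weighted (f phi : 'rV[R]_d -> R) : continuous f -> continuous phi ->
  continuous (fun y => f y * expR (phi y)).
Proof.
move=> cf cp; have ce : continuous (fun y => expR (phi y)).
  by move=> y; apply: continuous_comp; [exact: cp | exact: continuous_expR].
by move=> y; exact: (continuousM (cf y) (ce y)).
Qed.

(** Both the measures and the weights change, so that the two contributions to
    the difference of the integrals are handled by a single functional. *)
Definition weighted_diff I I' phi phi' f :=
  I (fun y => f y * expR (phi y)) - I' (fun y => f y * expR (phi' y)).

Lemma weighted_lin X I phi a (f g : 'rV[R]_d -> R) : state X I -> continuous phi ->
  continuous f -> continuous g ->
  I (fun y => (a * f y + g y) * expR (phi y)) =
  a * I (fun y => f y * expR (phi y)) + I (fun y => g y * expR (phi y)).
Proof.
move=> SI cp cf cg; rewrite -(state_lin SI); try exact: continuous_weighted.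
by congr I; apply/funext => y; rewrite mulrDl mulrA.
Qed.

Lemma weighted_norm X I phi P B f : state X I -> continuous phi ->
  bounded_by P phi -> continuous f -> bounded_by B f ->
  `|I (fun y => f y * expR (phi y))| <= expR P * B.
Proof.
move=> SI cp pP cf fB; apply: (state_norm_le SI); first exact: continuous_weighted.
move=> y _; rewrite normrM mulrC ler_pM//.
by rewrite ger0_norm ?expR_ge0// ler_expR (le_trans (ler_norm _)).
Qed.

Lemma weighted_diff_norm X I I' (w C0 P L B : R) phi phi' f :
  state X I -> state X I' -> dual_close w I I' -> 0 <= L -> 0 <= B ->
  lip L phi -> lip L phi' -> bounded_by P phi -> bounded_by P phi' ->
  (forall y, `|phi y - phi' y| <= C0 * w) ->
  bounded_by B f -> lip (d%:R * B) f ->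
  `|weighted_diff I I' phi phi' f| <= expR P * (C0 + (L + d%:R)) * w * B.
Proof.
move=> SI SI' II L0 B0 lp lp' bp bp' pp fB fL.
have [cp cp'] := (lip_continuous lp, lip_continuous lp').
have cf := lip_continuous fL.
have pos x : `|expR (phi' x)| <= expR P.
  by rewrite ger0_norm ?expR_ge0// ler_expR (le_trans (ler_norm _)).
rewrite /weighted_diff.
apply: le_trans (ler_distD (I (fun y => f y * expR (phi' y))) _ _) _.
have -> : expR P * (C0 + (L + d%:R)) * w * B =
    B * (expR P * (C0 * w)) + (B * (expR P * L) + d%:R * B * expR P) * w by ring.
apply: lerD.
  rewrite -(stateB SI); try exact: continuous_weighted.
  apply: (state_norm_le SI).
    by apply: continuous_sub; exact: continuous_weighted.
  move=> y _; rewrite -mulrBr normrM ler_pM//.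
  apply: le_trans (expR_diff_le (c := P) _ _) _.
  - exact: le_trans (ler_norm _) (bp y).
  - exact: le_trans (ler_norm _) (bp' y).
  by rewrite ler_wpM2l ?expR_ge0.
apply: (II _ (B * expR P)).
- by rewrite addr_ge0 ?mulr_ge0 ?expR_ge0.
- apply: lipM => //; first by rewrite mulr_ge0 ?expR_ge0.
  apply: lip_expR => // y; exact: le_trans (ler_norm _) (bp' y).
- by move=> y; rewrite normrM ler_pM.
Qed.

Lemma bC_weighted_integral k g X I phi P B :
  state X I -> continuous phi -> bounded_by P phi ->
  bC k.+1 B (fun z => expR (- g z)) ->
  bC k (expR P * B) (fun x => I (fun y => expR (phi y - cost_of g x y))).
Proof.
move=> SI cp pP gB.
have -> : (fun x => I (fun y => expR (phi y - cost_of g x y))) =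
    (fun x => I (fun y => expR (- g (row_mx x y)) * expR (phi y))).
  by apply/funext => x; congr I; apply/funext => y; rewrite -expRD addrC.
apply: (bC_kernel (J := fun f => I (fun y => f y * expR (phi y)))
  (A0 := expR P) (A := expR P) _ _ _ gB).
- by move=> a f1 f2 c1 c2; exact: (weighted_lin a SI cp c1 c2).
- by move=> B1 f c1 f1; exact: (weighted_norm SI cp pP c1 f1).
- move=> B1 f f1; apply: (weighted_norm SI) => //; first exact: bC_continuous f1.
  by move=> y; exact: bC_bound f1.
Qed.

(** Both potentials are - log of an integral of the kernel [expR (- g)], to which
    [bC_kernel] applies with the functional [weighted_diff]. *)
Lemma potential_diff k (M C0 : R) : 0 <= M -> 0 <= C0 -> exists2 C, 0 <= C &
  forall g X I I' (w : R) phi phi',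
    bC k.+1 M g -> state X I -> state X I' -> dual_close w I I' -> 0 <= w ->
    lip (d%:R * M) phi -> lip (d%:R * M) phi' ->
    bounded_by (3 * M) phi -> bounded_by (3 * M) phi' ->
    (forall y, `|phi y - phi' y| <= C0 * w) ->
    bC k (C * w) (fun x => stransform I (cost_of g) phi x -
                           stransform I' (cost_of g) phi' x).
Proof.
move=> M0 C00; have [B B0 HB] := @bC_expR R (d + d) k.+1 M.
have d0 : 0 < expR (- (3 * M + M)) by exact: expR_gt0.
have [C1 C10 HC1] := @bC_ln_diff R d k (expR (3 * M) * B) _ d0.
pose K := expR (3 * M) * (C0 + (d%:R * M + d%:R)).
have K0 : 0 <= K by rewrite mulr_ge0 ?expR_ge0// !addr_ge0 ?mulr_ge0.
exists (C1 * (K * B)); first by apply: mulr_ge0 => //; exact: mulr_ge0.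
move=> g X I I' w phi phi' gM SI SI' II w0 lp lp' bp bp' pp.
have Gk := good_cost_of gM.
have [cp cp'] := (lip_continuous lp, lip_continuous lp').
have gB : bC k.+1 B (fun z => expR (- g z)) := HB _ (bCN gM).
pose F x := I (fun y => expR (phi y - cost_of g x y)).
pose F' x := I' (fun y => expR (phi' y - cost_of g x y)).
have Fd x : expR (- (3 * M + M)) <= F x.
  by case/andP: (state_integrand SI Gk x cp bp).
have Fd' x : expR (- (3 * M + M)) <= F' x.
  by case/andP: (state_integrand SI' Gk x cp' bp').
have BF : bC k (expR (3 * M) * B) F by exact: (bC_weighted_integral SI cp bp gB).
have BF' : bC k (expR (3 * M) * B) F' by exact: (bC_weighted_integral SI' cp' bp' gB).
have BFF : bC k (K * w * B) (F - F').
  have -> : F - F' = (fun x => weighted_diff I I' phi phi' (fun y => expR (- g (row_mx x y)))).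
    apply/funext => x; rewrite /weighted_diff; congr (_ - _).
      by congr I; apply/funext => y; rewrite -expRD addrC.
    by congr I'; apply/funext => y; rewrite -expRD addrC.
  apply: (bC_kernel (J := weighted_diff I I' phi phi') (A0 := expR (3 * M) + expR (3 * M))
    _ _ _ gB).
  - move=> a f1 f2 c1 c2; rewrite /weighted_diff (weighted_lin _ SI)// (weighted_lin _ SI')//.
    by ring.
  - move=> B1 f c1 f1; apply: le_trans (ler_normB _ _) _; rewrite mulrDl.
    by apply: lerD; [exact: (weighted_norm SI) | exact: (weighted_norm SI')].
  - move=> B1 f f1; apply: (weighted_diff_norm SI SI' II) => //.
    + by rewrite mulr_ge0.
    + exact: bC_ge0 f1.
    + by move=> y; exact: bC_bound f1.
    + exact: bC_lip f1.
have := HC1 F F' _ Fd Fd' BF BF' BFF => /bCN.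
have -> : C1 * (K * w * B) = C1 * (K * B) * w by ring.
by congr bC; apply/funext => x; rewrite /stransform opprK fctE opprB addrC.
Qed.

(** The regularity of log F is that of log F - log 1. *)
Lemma stransform_Ck k M g X I phi P : bC k.+1 M g -> state X I ->
  continuous phi -> bounded_by P phi -> Ck k (stransform I (cost_of g) phi).
Proof.
move=> gM SI cp bp; have [B B0 HB] := @bC_expR R (d + d) k.+1 M.
have gB : bC k.+1 B (fun z => expR (- g z)) := HB _ (bCN gM).
pose F x := I (fun y => expR (phi y - cost_of g x y)).
have Gk := good_cost_of gM.
have BF : bC k (expR P * B) F by exact: (bC_weighted_integral SI cp bp gB).
pose e := Num.min 1 (expR (- (P + M))).
have e0 : 0 < e by rewrite lt_min ltr01 expR_gt0.
have Fe x : e <= F x.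
  by case/andP: (state_integrand SI Gk x cp bp) => H _; rewrite ge_min H orbT.
have e1 (x : 'rV[R]_d) : e <= (cst 1 : 'rV[R]_d -> R) x by rewrite ge_min lexx.
have B1 := bC_cst (m := d) k (1 : R).
have [C _ HC] := @bC_ln_diff R d k (expR P * B + `|1|) e e0.
have BF1 : bC k (expR P * B + `|1|) F by apply: bC_le BF; rewrite lerDl.
have B11 : bC k (expR P * B + `|1|) (cst 1 : 'rV[R]_d -> R).
  by apply: bC_le B1; rewrite lerDr (bC_ge0 BF).
have := HC _ _ _ Fe e1 BF1 B11 (bCD BF1 (bCN B11)) => /bCN/bC_Ck.
by congr Ck; apply/funext => x; rewrite fctE ln1 subr0.
Qed.

End PotentialRegularity.

(** * The Schrödinger map *)

Section Assembly.
Local Open Scope quotient_scope.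
Context {R : realType} {d : nat}.
Local Notation Rd := (Rd R d).
Implicit Types (X : set 'rV[R]_d) (mu nu : probability Rd R)
  (c g : 'rV[R]_(d + d) -> R) (phi psi : 'rV[R]_d -> R).

Lemma prob_on_nonempty X mu : prob_on X mu -> X !=set0.
Proof.
move=> muX; apply/set0P/negP => /eqP X0; move: muX.
by rewrite /prob_on/= X0 measure0 => /esym/eqP; rewrite onee_eq0.
Qed.

Lemma cost_of_swap g :
  cost_of (g \o @swap_rows R d) = (fun y x => cost_of g x y).
Proof. by apply/funext => y; apply/funext => x; rewrite /cost_of/= swap_rowsE. Qed.

Lemma eq_stransform X mu kap phi psi x : (forall y, X y -> phi y = psi y) ->
  stransform (integral_on X mu) kap phi x = stransform (integral_on X mu) kap psi x.
Proof.
move=> E; rewrite /stransform /integral_on; congr (- ln _).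
by apply: eq_Rintegral => y yX; rewrite E//; exact: set_mem.
Qed.

Section OneSystem.
Context {k : nat} {M : R} {g c : 'rV[R]_(d + d) -> R} {X1 X2 : set 'rV[R]_d}.
Hypotheses (gM : bC k.+1 M g) (cX1 : compact X1) (cX2 : compact X2)
  (gc : {in prod_set X1 X2, g =1 c}).
Context {mu1 mu2 : probability Rd R}.
Hypotheses (mu1X : prob_on X1 mu1) (mu2X : prob_on X2 mu2).

Let I1 := integral_on X1 mu1.
Let I2 := integral_on X2 mu2.
Let SI1 : state X1 I1 := state_integral cX1 mu1X.
Let SI2 : state X2 I2 := state_integral cX2 mu2X.
Let Gk := good_cost_of gM.
Let Gk' := good_costT Gk.

Let gcE x y : X1 x -> X2 y -> cost_of g x y = c (row_mx x y).
Proof. by move=> Xx Xy; apply: gc; apply/mem_set; exists x => //; exists y. Qed.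

(** Off the sets the potentials carry no information; the system itself
    provides the extension to the whole space. *)
Lemma system_globalise (phi : CkFun k X1 * CkFun k X2) :
  schrodinger_system c X1 X2 mu1 mu2 phi.1 phi.2 ->
  exists a psi1 psi2, [/\ solves I1 I2 (cost_of g) psi1 psi2, psi1 0 = 0,
    [/\ lip (d%:R * M) psi1, lip (d%:R * M) psi2,
        bounded_by (2 * M) psi1 & bounded_by (3 * M) psi2],
    forall x, X1 x -> phi.1 x = psi1 x + a & forall y, X2 y -> phi.2 y = psi2 y - a].
Proof.
move=> sys; have [x1 Xx1] := prob_on_nonempty mu1X.
have [x2 Xx2] := prob_on_nonempty mu2X.
have [f2 [Cf2 f2E]] : Ck_ext k X2 phi.2 !=set0 by exact/asboolP/ckfunP.
have cf2 : continuous f2 := Ck_sub (leq0n k) Cf2.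
have [B B0 f2B] := continuous_compact_bounded cX2 cf2.
pose t y := Num.max (- B) (Num.min B (f2 y)).
have ct : continuous t.
  move=> y; apply: (@continuous_max _ _ (cst (- B)) (fun y => Num.min B (f2 y))).
    exact: cst_continuous.
  by apply: (@continuous_min _ _ (cst B) f2); [exact: cst_continuous | exact: cf2].
have tB : bounded_by B t.
  move=> y; rewrite ler_norml /t le_max lexx/= ge_max ge_min lexx andbT.
  by rewrite lerNl (le_trans _ B0)// oppr_le0.
have tE y : X2 y -> t y = phi.2 y.
  move=> Xy; rewrite -f2E; last exact/mem_set.
  have := f2B y Xy; rewrite ler_norml => /andP[h1 h2].
  by rewrite /t min_r// max_r.
pose q1 := stransform I2 (cost_of g) t.
pose q2 := stransform I1 (fun y x => cost_of g x y) q1.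
have q1l : lip (d%:R * M) q1 := stransform_lip SI2 Gk ct tB.
have cq1 := lip_continuous q1l.
have q1b : bounded_by (B + M) q1 := stransform_bounded SI2 Gk ct tB.
have q1E x : X1 x -> q1 x = phi.1 x.
  move=> Xx; have [-> _] := sys x x2 Xx Xx2.
  rewrite /q1 /stransform /I2 /integral_on; congr (- ln _).
  apply: eq_Rintegral => y /set_mem yX; rewrite tE// gcE//.
have q2l : lip (d%:R * M) q2 := stransform_lip SI1 Gk' cq1 q1b.
have cq2 := lip_continuous q2l.
have q2b : bounded_by (B + M + M) q2 := stransform_bounded SI1 Gk' cq1 q1b.
have q2E y : X2 y -> q2 y = phi.2 y.
  move=> Xy; have [_ ->] := sys x1 y Xx1 Xy.
  rewrite /q2 /stransform /I1 /integral_on; congr (- ln _).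
  apply: eq_Rintegral => x /set_mem xX; rewrite q1E// gcE//.
have q12 : forall x, q1 x = stransform I2 (cost_of g) q2 x.
  by move=> x; apply: eq_stransform => y Xy; rewrite tE// q2E.
have q21 y : q2 y = stransform I1 (fun y x => cost_of g x y) q1 y by [].
clearbody q2; clearbody q1.
pose psi1 x := q1 x + - q1 0; pose psi2 y := q2 y + q1 0.
have S : solves I1 I2 (cost_of g) psi1 psi2.
  split => [x|y].
    apply: etrans (esym (stransform_shift SI2 Gk (q1 0) x cq2 q2b)).
    by rewrite /psi1 q12.
  apply: etrans (esym (stransform_shift SI1 Gk' (- q1 0) y cq1 q1b)).
  by rewrite opprK /psi2 q21.
have c1 : continuous psi1.
  exact: (continuous_sub cq1 (@cst_continuous _ _ (q1 0))).
have c2 : continuous psi2.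
  move=> y; apply: (continuousD (cq2 y)); exact: cst_continuous.
have z : psi1 0 = 0 by rewrite /psi1 subrr.
exists (q1 0), psi1, psi2; split => //.
- have P0 (h : 'rV[R]_d -> R) Q a : bounded_by Q h -> bounded_by (Q + `|a|) (fun x => h x + a).
    by move=> hQ x; apply: le_trans (ler_normD _ _) _; rewrite lerD2r.
  have b1 := P0 _ _ (- q1 0) q1b; have b2 := P0 _ _ (q1 0) q2b.
  pose Q := Num.max (B + M + `|- q1 0|) (B + M + M + `|q1 0|).
  apply: (solution_bounds Gk (P := Q) SI1 SI2 S z c1 c2).
    by move=> x; rewrite le_max b1.
  by move=> x; rewrite le_max b2 orbT.
- by move=> x Xx; rewrite /psi1 subrK q1E.
- by move=> y Xy; rewrite /psi2 addrK q2E.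
Qed.

Lemma system_exists : exists phi : CkFun k X1 * CkFun k X2,
  schrodinger_system c X1 X2 mu1 mu2 phi.1 phi.2.
Proof.
have [phi1 [phi2 [[E1 E2] l1 l2 b1 b2]]] := solution_exists cX1 SI1 SI2 Gk.
have C1 : phi1 \in Ck_on k X1.
  apply/asboolP; exists phi1; split => //.
  have -> : phi1 = stransform I2 (cost_of g) phi2 by exact/funext.
  exact: (stransform_Ck gM SI2 (lip_continuous l2) b2).
have C2 : phi2 \in Ck_on k X2.
  apply/asboolP; exists phi2; split => //.
  have -> : phi2 = stransform I1 (cost_of (g \o @swap_rows R d)) phi1.
    by rewrite cost_of_swap; exact/funext.
  exact: (stransform_Ck (bC_swap gM) SI1 (lip_continuous l1) b1).
exists (MkCkFun C1, MkCkFun C2) => x1 x2 Xx1 Xx2 /=; split.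
  rewrite E1 /stransform /I2 /integral_on; congr (- ln _).
  by apply: eq_Rintegral => y /set_mem yX; rewrite gcE.
rewrite E2 /stransform /I1 /integral_on; congr (- ln _).
by apply: eq_Rintegral => y /set_mem yX; rewrite gcE.
Qed.

Lemma schrodinger_mapP : exists phi : CkFun k X1 * CkFun k X2,
  schrodinger_map k c X1 X2 mu1 mu2 = \pi_(Ctilde k X1 X2) phi /\
  schrodinger_system c X1 X2 mu1 mu2 phi.1 phi.2.
Proof.
have [phi0 S0] := system_exists.
pose S := [set \pi_(Ctilde k X1 X2) phi | phi in
  [set phi : CkFun k X1 * CkFun k X2 | schrodinger_system c X1 X2 mu1 mu2 phi.1 phi.2]].
have : S (schrodinger_map k c X1 X2 mu1 mu2).
  by apply: xgetPex; exists (\pi_(Ctilde k X1 X2) phi0); exists phi0.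
by case=> phi sys <-; exists phi.
Qed.

End OneSystem.

Lemma Ck_norm_le k (K : set 'rV[R]_d) (f h : 'rV[R]_d -> R) B :
  {in K, h =1 f} -> bC k B h -> (Ck_norm k K f <= B%:E)%E.
Proof.
move=> hf hB; apply: le_trans (norm_of_bC hB); apply: ereal_inf_lbound.
by exists h => //; split => //; exact: bC_Ck hB.
Qed.

(** The constant that normalises the potentials at the origin is absorbed by the
    infimum over [kappa] in the norm of the quotient. *)
Lemma schrodinger_map_lipschitz k (M : R) : 0 <= M -> exists C : R, 0 < C /\
  forall (X1 X2 : set 'rV[R]_d) (c g : 'rV[R]_(d + d) -> R)
    (mu1 mu2 mu1' mu2' : probability Rd R) (w : R),
    bC k.+1 M g -> compact X1 -> compact X2 -> {in prod_set X1 X2, g =1 c} ->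
    prob_on X1 mu1 -> prob_on X2 mu2 -> prob_on X1 mu1' -> prob_on X2 mu2' ->
    (W2_pair mu1 mu2 mu1' mu2' <= w%:E)%E -> 0 <= w ->
    (Ctilde_norm (schrodinger_map k c X1 X2 mu1 mu2 -
                  schrodinger_map k c X1 X2 mu1' mu2')%R <= (C * w)%:E)%E.
Proof.
move=> M0; pose C0 := expR (2 * (3 * M + M)) * (d%:R * M + d%:R * M) *
  (4 / expR (- (4 * M)) + 1).
have C00 : 0 <= C0.
  by rewrite !mulr_ge0 ?expR_ge0 ?addr_ge0 ?mulr_ge0 ?divr_ge0 ?expR_ge0.
have [C C_ge0 HC] := @potential_diff R d k M C0 M0 C00.
(* One [C] for each potential; adding 1 makes the constant positive. *)
exists (C + C + 1); split; first by rewrite ltr_wpDl// addr_ge0.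
move=> X1 X2 c g mu1 mu2 mu1' mu2' w gM cX1 cX2 gc h1 h2 h1' h2' ww w0.
have [phi [-> sys]] := schrodinger_mapP gM cX1 cX2 gc h1 h2.
have [phi' [-> sys']] := schrodinger_mapP gM cX1 cX2 gc h1' h2'.
have [a [p1 [p2 [S z [l1 l2 b1 b2] e1 e2]]]] := system_globalise gM cX1 cX2 gc h1 h2 sys.
have [a' [p1' [p2' [S' z' [l1' l2' b1' b2'] e1' e2']]]] :=
  system_globalise gM cX1 cX2 gc h1' h2' sys'.
have [w1 w2] := W2_le_pair ww.
have D1 := dual_close_W2 cX1 h1 h1' w1; have D2 := dual_close_W2 cX2 h2 h2' w2.
have [SI1 SI1'] := (state_integral cX1 h1, state_integral cX1 h1').
have [SI2 SI2'] := (state_integral cX2 h2, state_integral cX2 h2').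
have wide (h : 'rV[R]_d -> R) : bounded_by (2 * M) h -> bounded_by (3 * M) h.
  by move=> hb x; apply: le_trans (hb x) _; rewrite ler_wpM2r// ler_nat.
have [u1 u2] := solution_stable SI1 SI2 SI1' SI2' (good_cost_of gM) D1 D2 S S' z z'
  (lip_continuous l1) (lip_continuous l2) (lip_continuous l1') (lip_continuous l2')
  (wide _ b1) b2 (wide _ b1') b2'.
have B1 := HC _ _ _ _ _ _ _ gM SI2 SI2' D2 w0 l2 l2' b2 b2' u2.
have B2 := HC _ _ _ _ _ _ _ (bC_swap gM) SI1 SI1' D1 w0 l1 l1' (wide _ b1) (wide _ b1') u1.
have -> : \pi_(Ctilde k X1 X2) phi - \pi_(Ctilde k X1 X2) phi' =
    \pi_(Ctilde k X1 X2) (phi - phi') by rewrite raddfB.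
rewrite Ctilde_norm_pi; apply: (@le_trans _ _
  (Ck_norm k X1 (fun x => (phi - phi').1 x - (a - a'))%R +
   Ck_norm k X2 (fun x => (phi - phi').2 x + (a - a'))%R)%E).
  by apply: ereal_inf_lbound; exists (a - a').
apply: (@le_trans _ _ ((C * w)%:E + (C * w)%:E)%E); last first.
  by rewrite -EFinD lee_fin !mulrDl lerDl mul1r.
case: S S' => [E1 E2] [E1' E2']; apply: leeD.
- apply: (Ck_norm_le _ B1) => x /set_mem Xx.
  rewrite -E1 -E1' -[(phi - phi').1 x]/(phi.1 x - phi'.1 x) e1// e1'//; ring.
- rewrite cost_of_swap in B2; apply: (Ck_norm_le _ B2) => x /set_mem Xx.
  rewrite -E2 -E2' -[(phi - phi').2 x]/(phi.2 x - phi'.2 x) e2// e2'//; ring.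
Qed.

End Assembly.

Theorem theorem1p1 (R : realType) (d k : nat) (hk : (0 < k)%N) :
  exists C : \bar R -> R, (forall M, 0 < C M) /\
  forall (X1 X2 : set 'rV[R]_d) (c : 'rV[R]_(d + d) -> R),
    compact X1 -> convex_set X1 -> compact X2 -> convex_set X2 ->
    c \in Ck_on k.+1 (prod_set X1 X2) ->
    forall mu1 mu2 mu1' mu2' : probability (Rd R d) R,
      prob_on X1 mu1 -> prob_on X2 mu2 -> prob_on X1 mu1' -> prob_on X2 mu2' ->
      (Ctilde_norm (schrodinger_map k c X1 X2 mu1 mu2 -
                    schrodinger_map k c X1 X2 mu1' mu2')%R
       <= (C (Ck_norm k.+1 (prod_set X1 X2) c))%:E *
          W2_pair mu1 mu2 mu1' mu2')%E.
Proof.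
(* An extension of norm less than ||c|| + 1 exists by definition of the infimum. *)
have bound (m : \bar R) : 0 <= `|fine m| + 1 by rewrite addr_ge0.
have /choice[C HC] := fun m => @schrodinger_map_lipschitz R d k _ (bound m).
exists C; split => [m|]; first by case: (HC m).
move=> X1 X2 c cX1 _ cX2 _ cC mu1 mu2 mu1' mu2' h1 h2 h1' h2'.
set m := Ck_norm _ _ _; have [C0 HCm] := HC m.
have cX : compact (prod_set X1 X2).
  have -> : prod_set X1 X2 = (fun z => row_mx z.1 z.2) @` (X1 `*` X2).
    apply/seteqP; split => [_ [x Xx [y Xy <-]]|_ [[x y] [/= Xx Xy] <-]].
      by exists (x, y).
    by exists x => //; exists y.
  apply: continuous_compact; last exact: compact_setX.
  apply: continuous_subspaceT; apply: (@lip_continuous _ _ _ 1) => z z'.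
  rewrite mul1r opp_row_mx add_row_mx; apply: rV_norm_row_mx.
    by rewrite prod_normE le_max lexx.
  by rewrite prod_normE le_max lexx orbT.
have moo : (m < +oo)%E by exact: Ck_norm_lt_pinfty.
have /ereal_inf_lt[_ [g [Cg gE] <-] gm] : (m < (`|fine m| + 1)%:E)%E.
  move: moo; case: (m) => [r _|//|_]; last exact: ltNyr.
  by rewrite lte_fin (le_lt_trans (ler_norm r))// ltrDl.
have gM := bC_of_norm Cg (ltW gm).
have W0 : (0 <= W2_pair mu1 mu2 mu1' mu2')%E by exact: poweR_ge0.
have H w := HCm X1 X2 c g mu1 mu2 mu1' mu2' w gM cX1 cX2 gE h1 h2 h1' h2'.
move: W0 H; case: (W2_pair _ _ _ _) => [w| |] //.
  by rewrite lee_fin => w0 H; rewrite -EFinM; exact: H.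
by move=> _ _; rewrite gt0_muley ?leey// lte_fin.
Qed.
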